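(* Let $d=\omega(1)$ and $n=\omega(d\log d)$ be integers, let $M\in\mathbb{R}^{d\times n}$ be a Komlós matrix, and let $R\in\mathbb{R}^{d\times n}$ be a Rademacher matrix. Then asymptotically almost surely $$\mathrm{DISC}\left(M+\frac{1}{\sqrt d}R\right)\le 8d^{-1/2}.$$ Explicitly: for all sequences of positive integers $(d_j)_j,(n_j)_j$ with $d_j\to\infty$ and $n_j/(d_j\log d_j)\to\infty$, and all Komlós matrices $M_j\in\mathbb{R}^{d_j\times n_j}$, if $R_j\in\mathbb{R}^{d_j\times n_j}$ is a Rademacher matrix, then $\Pr\left[\mathrm{DISC}(M_j+R_j/\sqrt{d_j})\le 8d_j^{-1/2}\right]\to 1$ as $j\to\infty$.
   Context: For $A\in\mathbb{R}^{d\times n}$, the discrepancy of $A$ is $\mathrm{DISC}(A):=\min_{x\in\{-1,1\}^n}\|Ax\|_\infty$. A matrix $M\in\mathbb{R}^{d\times n}$ is called Komlós if every column $v$ of $M$ satisfies $\|v\|_2\le 1$. A Rademacher matrix is a random matrix whose entries are independent and each takes the values $-1$ and $1$ with probability $1/2$ each. *)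

(* Defs.v *)
From mathcomp Require Import all_boot all_order all_algebra.
From mathcomp Require Import all_classical all_reals all_analysis.

Set Implicit Arguments.
Unset Strict Implicit.
Unset Printing Implicit Defensive.

Import Order.TTheory GRing.Theory Num.Theory.
Import numFieldNormedType.Exports.

Local Open Scope classical_set_scope.
Local Open Scope ring_scope.

Definition sign_vectors (R : realType) (n : nat) : set 'cV[R]_n :=
  [set x | forall k, x k 0 = 1 \/ x k 0 = -1].
Arguments sign_vectors : clear implicits.

(* MathComp-Analysis' norm on matrices is the largest absolute value of an
   entry, so that `|A *m x| is the sup norm of A x. The infimum is a minimum:
   see [DISC_attained] and [DISC_le]. *)
Definition DISC (R : realType) (d n : nat) (A : 'M[R]_(d, n)) : R :=
  inf [set `|A *m x| | x in sign_vectors R n].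

Definition komlos (R : realType) (d n : nat) (M : 'M[R]_(d, n)) : Prop :=
  forall k : 'I_n, Num.sqrt (\sum_(i < d) M i k ^+ 2) <= 1.

Definition mutually_independent (R : realType) (disp : measure_display)
    (T : measurableType disp) (P : probability T R) (I : finType)
    (X : I -> {RV P >-> R}) : Prop :=
  forall (J : {set I}) (B : I -> set R),
    (forall i, measurable (B i)) ->
    P (\bigcap_(i in [set` J]) (X i @^-1` B i)) =
    (\prod_(i in J) P (X i @^-1` B i))%E.

Definition random_matrix (R : realType) (disp : measure_display)
    (T : measurableType disp) (P : probability T R) (d n : nat)
    (X : 'I_d -> 'I_n -> {RV P >-> R}) (w : T) : 'M[R]_(d, n) :=
  \matrix_(i < d, k < n) X i k w.

Definition rademacher (R : realType) (disp : measure_display)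
    (T : measurableType disp) (P : probability T R) (d n : nat)
    (X : 'I_d -> 'I_n -> {RV P >-> R}) : Prop :=
  mutually_independent (fun ik : 'I_d * 'I_n => X ik.1 ik.2) /\
  forall i k, P (X i k @^-1` [set 1]) = (2^-1)%:E /\
              P (X i k @^-1` [set -1]) = (2^-1)%:E.

Lemma DISC_le (R : realType) (d n : nat) (A : 'M[R]_(d, n)) (x : 'cV[R]_n) :
  sign_vectors R n x -> DISC A <= `|A *m x|.
Proof.
move=> sx; apply: ge_inf; last by exists x.
by exists 0 => _ [y _ <-]; exact: normr_ge0.
Qed.

Lemma DISC_attained (R : realType) (d n : nat) (A : 'M[R]_(d, n)) :
  exists2 x, sign_vectors R n x & DISC A = `|A *m x|.
Proof.
pose v (s : {ffun 'I_n -> bool}) : 'cV[R]_n := \col_k (-1) ^+ s k.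
have vs s : sign_vectors R n (v s).
  by move=> k; rewrite mxE; case: (s k); [right|left]; rewrite ?expr1 ?expr0.
have sv x : sign_vectors R n x -> exists s, x = v s.
  move=> sx; exists [ffun k => x k 0 == -1]; apply/colP => k.
  rewrite mxE ffunE; case: (sx k) => ->; last by rewrite eqxx expr1.
  by rewrite -subr_eq0 opprK -(natrD _ 1 1) pnatr_eq0 expr0.
pose s0 := [arg min_(s < [ffun=> false] | true) `|A *m v s|]%O.
have s0P s : `|A *m v s0| <= `|A *m v s|.
  by rewrite /s0; case: arg_minP => // t _; exact.
exists (v s0); first exact: vs.
apply/eqP; rewrite eq_le DISC_le//=; apply: lb_le_inf.
  by exists `|A *m v s0|, (v s0).
by move=> _ [x /sv[s ->] <-].
Qed.

(* Main.v *)
Require Import Defs.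
From mathcomp Require Import all_boot all_order all_algebra.
From mathcomp Require Import all_classical all_reals all_analysis.
From mathcomp Require Import zify ring lra.
Import Order.TTheory GRing.Theory Num.Theory.
Import numFieldNormedType.Exports.
Set Implicit Arguments.
Unset Strict Implicit.
Unset Printing Implicit Defensive.
Local Open Scope classical_set_scope.
Local Open Scope ring_scope.

(* Second moment method over the noise, with signs x weighted by a subgaussian
   distribution mu. The Gram-Schmidt walk applied to the columns of the
   identity stacked over M gives mu for which both x and Mx are subgaussian.
   For a row r of the noise and a target a_i = - sqrt d (Mx)_i, let the slot of
   (x, i) be the two consecutive possible values of <r, x> closest to a_i, and
   let p_i(x) be the probability that <r, x> falls in it. The weighted count
   S = sum_x mu(x) prod_i 1[row i hits the slot of (x, i)] / p_i(x), restricted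
   to x with |Mx|_oo <= 8 sqrt(ln d), has mean close to 1, and
   E S^2 = E_{x,y} prod_i p_i(x,y) / (p_i(x) p_i(y)).
   With g = <x, y>, local estimates of binomial coefficients bound the product
   by exp(o(1) + O(d g^2 / n^2) + O(d / n^2) <Mx, My>^2) when |g| <= n / 2, and
   subgaussianity makes the expectation of this 1 + o(1) as n >> d ln d. The
   trivial bound exp(O(d ln n)) on the product suffices when |g| > n / 2, an
   event of probability exp(- Omega(n)). Hence E S^2 = 1 + o(1), so that S > 0
   asymptotically almost surely. *)

(** * The moment generating function of a sign *)

(** Uniform signs x would not do: a row of M may have norm sqrt n, which puts its target near sqrt
    (d n), out of reach of a noise sum of order sqrt n. Under mu the targets are O(sqrt (d ln d)) =
    o(sqrt n), where a binomial law is still close to its peak. Dividing by p_i(x) gives every x the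
    mean contribution mu(x), whatever its targets. For two vectors x and y, the targets interact
    through a sum over i of about g a_i(x) a_i(y) / n^2, that is d g <Mx, My> / n^2, and the
    arithmetic-geometric mean inequality separates g from <Mx, My>. For fixed x both are linear in
    y, and stacking the identity over M makes both subgaussian under one mu, with variance proxies
    O(n) and O(d ln d). Constants are not optimized: gamma = d ln d / n is only taken below 10^-6,
    and the slots in fact give discrepancy 2 / sqrt d. *)

Lemma expR_le_inv1B (R : realType) (x : R) : x < 1 -> expR x <= (1 - x)^-1.
Proof.
move=> x1; rewrite -[x in leLHS]opprK expRN lef_pV2 ?posrE ?expR_gt0 ?subr_gt0//.
exact: expR_ge1Dx.
Qed.

Lemma inv1B_le_expR (R : realType) (x : R) :
  0 <= x <= 2^-1 -> (1 - x)^-1 <= expR (2 * x).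
Proof.
move=> /andP[x0 x1]; apply: le_trans (expR_ge1Dx _).
by rewrite -[leLHS]mul1r ler_pdivrMr; nra.
Qed.

(** For x^2 <= 1/2, the bound e^x <= 1 / (1 - x) at x and - x averages to 1 / (1 - x^2); beyond, e^x
    alone is small enough. The sharp exponent x^2 / 2 is given up for this elementary proof. *)
Lemma cosh_le (R : realType) (x : R) :
  (expR x + expR (- x)) / 2 <= expR (2 * x ^+ 2).
Proof.
wlog x0 : x / 0 <= x => [H|].
  case: (lerP 0 x) => [/H//|x0].
  by rewrite addrC -sqrrN -{2}[x]opprK; apply: H; rewrite oppr_ge0 ltW.
have [x1|x1] := lerP (x ^+ 2) 2^-1.
  have x2 : x < 1 by nra.
  apply: le_trans (inv1B_le_expR _); last by rewrite sqr_ge0.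
  apply: (@le_trans _ _ (((1 - x)^-1 + (1 + x)^-1) / 2)).
    rewrite ler_pM2r//; apply: lerD; first exact: expR_le_inv1B.
    by rewrite -[X in (1 + X)^-1]opprK; apply: expR_le_inv1B; lra.
  rewrite le_eqVlt; apply/orP; left; apply/eqP; field.
  by apply/and3P; split; apply/eqP; nra.
apply: (@le_trans _ _ (expR x)).
  have : expR (- x) <= expR x by rewrite ler_expR; lra.
  lra.
by rewrite ler_expR; nra.
Qed.

(* The moment generating function of X - z, where X is a sign of mean z. *)
Definition sign_mgf (R : realType) (z t : R) : R :=
  expR (- (z * t)) * ((1 + z) / 2 * expR t + (1 - z) / 2 * expR (- t)).

Section SignMgf.
Variable R : realType.
Implicit Types z t a : R.

Lemma sign_mgfE z t : sign_mgf z t =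
  (1 + z) / 2 * expR (t * (1 - z)) + (1 - z) / 2 * expR (- (t * (1 + z))).
Proof.
have -> : t * (1 - z) = - (z * t) + t by ring.
have -> : - (t * (1 + z)) = - (z * t) + - t by ring.
by rewrite /sign_mgf !expRD; ring.
Qed.

Lemma sign_mgfN z t : sign_mgf z (- t) = sign_mgf (- z) t.
Proof. by rewrite /sign_mgf !mulrN mulNr !opprK addrC. Qed.

Lemma sign_mgf_ge1 z t : -1 <= z <= 1 -> 1 <= sign_mgf z t.
Proof.
move=> /andP[z1 z2]; rewrite sign_mgfE.
have := expR_ge1Dx (t * (1 - z)); have := expR_ge1Dx (- (t * (1 + z))).
nra.
Qed.

(** Symmetrization: [sign_mgf z (- t)] is at least 1, and the product of the two is the moment
    generating function of X - X' for an independent copy X', namely 1 + (1 - z^2) (cosh^2 t - 1) <=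
    cosh^2 t. *)
Lemma sign_mgf_le z t : -1 <= z <= 1 -> sign_mgf z t <= expR (4 * t ^+ 2).
Proof.
move=> zP; have zN : -1 <= - z <= 1 by case/andP: zP => *; apply/andP; split; lra.
apply: (@le_trans _ _ (sign_mgf z t * sign_mgf z (- t))).
  rewrite ler_peMr ?sign_mgfN ?sign_mgf_ge1//.
  exact: le_trans ler01 (sign_mgf_ge1 _ zP).
have -> : sign_mgf z t * sign_mgf z (- t) =
    1 + (1 - z ^+ 2) * (((expR t + expR (- t)) / 2) ^+ 2 - 1).
  rewrite sign_mgfN /sign_mgf mulNr opprK mulrACA -expRD addNr expR0 mul1r.
  have := expRxMexpNx_1 t; set a := expR t; set b := expR _ => ab.
  transitivity ((1 - z ^+ 2) / 4 * (a ^+ 2 + b ^+ 2) + (1 + z ^+ 2) / 2 * (a * b)).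
    by field.
  by rewrite [in RHS]expr_div_n [in RHS]sqrrD ab; field.
apply: (@le_trans _ _ (((expR t + expR (- t)) / 2) ^+ 2)).
  have : 1 <= (expR t + expR (- t)) / 2.
    by have := expR_ge1Dx t; have := expR_ge1Dx (- t); lra.
  move: (_ / 2) => c c1.
  have : 0 <= z ^+ 2 * (c ^+ 2 - 1) by rewrite mulr_ge0 ?sqr_ge0//; nra.
  lra.
have -> : 4 * t ^+ 2 = 2%:R * (2 * t ^+ 2) by ring.
rewrite expRM_natl; apply: lerXn2r; rewrite ?nnegrE ?expR_ge0 ?cosh_le//.
Qed.

Lemma sign_mgf_mono z a t : -1 <= z <= 1 -> 0 <= a -> 0 <= t ->
  sign_mgf z a <= sign_mgf z (a + t).
Proof.
move=> /andP[z1 z2] a0 t0; rewrite !sign_mgfE !mulrDl opprD !expRD.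
have := expR_ge1Dx (t * (1 - z)); have := expR_ge1Dx (- (t * (1 + z))).
have : expR (- (a * (1 + z))) <= 1 by rewrite expR_le1; nra.
have : 1 <= expR (a * (1 - z)) by rewrite -[leLHS]expR0 ler_expR; nra.
set A := expR _; set B := expR _; set D := expR _; set C := expR _ => A1 B1 D1 C1.
have B0 : 0 <= B by exact: expR_ge0.
have : (1 + z) / 2 * (A * (t * (1 - z))) <= (1 + z) / 2 * (A * (C - 1)).
  by apply: ler_wpM2l; [lra|apply: ler_wpM2l; lra].
have : (1 - z) / 2 * (B * - (t * (1 + z))) <= (1 - z) / 2 * (B * (D - 1)).
  by apply: ler_wpM2l; [lra|apply: ler_wpM2l; lra].
have : 0 <= (t * (1 - z) * (1 + z)) * (A - B).
  by apply: mulr_ge0; [apply: mulr_ge0; nra|lra].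
lra.
Qed.

(* Tilting a sign of mean z by a gives a sign of mean z' <= z + 8 a. *)
Lemma sign_mgf_tilt z a t : -1 <= z <= 1 -> 0 <= a -> 0 <= t ->
  sign_mgf z (a + t) <= sign_mgf z a * expR (4 * (t ^+ 2 + 2 * (a * t))).
Proof.
move=> zP a0 t0; have h1 := sign_mgf_ge1 a zP; case/andP: (zP) => z1 z2.
have h0 : 0 < sign_mgf z a by apply: lt_le_trans h1.
(* The probability of the sign 1 once the law is reweighted by e^{a X}; [z'] below is the tilted
   mean. *)
set q := (1 + z) / 2 * expR (a * (1 - z)) / sign_mgf z a.
have q1 : 1 - q = (1 - z) / 2 * expR (- (a * (1 + z))) / sign_mgf z a.
  by rewrite -{1}(divff (lt0r_neq0 h0)) -mulrBl {1}sign_mgfE addrAC subrr add0r.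
have q0 : 0 <= q by rewrite divr_ge0 ?(ltW h0)// mulr_ge0 ?expR_ge0//; lra.
have q2 : 0 <= 1 - q.
  by rewrite q1 divr_ge0 ?(ltW h0)// mulr_ge0 ?expR_ge0//; lra.
pose z' := 2 * q - 1.
have z'P : -1 <= z' <= 1 by rewrite /z'; apply/andP; split; lra.
have -> : sign_mgf z (a + t) =
    sign_mgf z a * (expR (t * (z' - z)) * sign_mgf z' t).
  rewrite [sign_mgf z' t]sign_mgfE.
  have -> : (1 + z') / 2 = q by rewrite /z'; field.
  have -> : (1 - z') / 2 = 1 - q by rewrite /z'; field.
  rewrite q1 /q sign_mgfE.
  have -> : (a + t) * (1 - z) = a * (1 - z) + (t * (z' - z) + t * (1 - z')) by ring.
  have -> : - ((a + t) * (1 + z)) =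
    - (a * (1 + z)) + (t * (z' - z) + - (t * (1 + z'))) by ring.
  by rewrite !expRD; field; rewrite gt_eqF.
rewrite ler_wpM2l ?(ltW h0)//.
have -> : 4 * (t ^+ 2 + 2 * (a * t)) = t * (8 * a) + 4 * t ^+ 2 by ring.
rewrite expRD; apply: ler_pM; rewrite ?expR_ge0 ?sign_mgf_le//.
  exact: le_trans ler01 (sign_mgf_ge1 _ z'P).
rewrite ler_expR; apply: ler_wpM2l => //.
have [a1|a1] := lerP 4^-1 a; first by case/andP: z'P => *; lra.
have : z' - z <= (expR (a * (1 - z)) - expR (- (a * (1 + z)))) / 2.
  have -> : z' - z = (1 - z ^+ 2) / sign_mgf z a *
      ((expR (a * (1 - z)) - expR (- (a * (1 + z)))) / 2).
    have -> : z' - z = ((1 - z) * ((1 + z) / 2 * expR (a * (1 - z))) -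
        (1 + z) * ((1 - z) / 2 * expR (- (a * (1 + z))))) / sign_mgf z a.
      rewrite /z' -[LHS](mulfK (lt0r_neq0 h0)); congr (_ / _).
      have qS : q * sign_mgf z a = (1 + z) / 2 * expR (a * (1 - z)).
        by rewrite /q divfK ?gt_eqF.
      transitivity (2 * (q * sign_mgf z a) - (1 + z) * sign_mgf z a); first by ring.
      by rewrite qS sign_mgfE; field.
    by field; rewrite gt_eqF.
  rewrite ler_piMl//.
    have : expR (- (a * (1 + z))) <= expR (a * (1 - z)) by rewrite ler_expR; nra.
    lra.
  by rewrite ler_pdivrMr// mul1r; have := sqr_ge0 z; lra.
have : expR (a * (1 - z)) <= (1 - 2 * a)^-1.
  by apply: le_trans (expR_le_inv1B _); [rewrite ler_expR; nra|lra].
have : (1 - 2 * a)^-1 <= 1 + 4 * a.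
  by rewrite -[leLHS]mul1r ler_pdivrMr; nra.
have := expR_ge1Dx (- (a * (1 + z))).
nra.
Qed.

(** By symmetry a >= 0. For t < 0, either a + t >= 0 and monotonicity applies, or |a + t| <= |t| and
    [sign_mgf_le] is enough. *)
Lemma sign_mgf_shift z a t : -1 <= z <= 1 ->
  sign_mgf z (a + t) <= sign_mgf z a * expR (4 * (t ^+ 2 + 2 * `|a * t|)).
Proof.
wlog a0 : z a t / 0 <= a => [H zP|zP].
  have [/H|a0] := lerP 0 a; first exact.
  have := H (- z) (- a) (- t).
  rewrite -opprD -!sign_mgfN !opprK mulrNN sqrrN; apply; first lra.
  by case/andP: zP => *; apply/andP; split; lra.
have h1 := sign_mgf_ge1 a zP.
have h0 : 0 < sign_mgf z a by apply: lt_le_trans h1.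
have e0 : 0 <= 4 * (t ^+ 2 + 2 * `|a * t|).
  by have := normr_ge0 (a * t); have := sqr_ge0 t; lra.
have [t0|t0] := lerP 0 t.
  by rewrite ger0_norm ?mulr_ge0//; exact: sign_mgf_tilt.
have [at0|at0] := lerP 0 (a + t).
  apply: (@le_trans _ _ (sign_mgf z a)).
    have := @sign_mgf_mono z (a + t) (- t) zP at0.
    by rewrite addrK; apply; lra.
  by rewrite ler_peMr ?(ltW h0)// -[leLHS]expR0 ler_expR.
apply: (le_trans (sign_mgf_le _ zP)).
apply: (@le_trans _ _ (expR (4 * (t ^+ 2 + 2 * `|a * t|)))); last first.
  by rewrite ler_peMl ?expR_ge0.
by rewrite ler_expR; have := normr_ge0 (a * t); nra.
Qed.

(* Junk values: 0^-1 = 0, which is the right convention when u or v vanishes. *)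
Lemma cauchy_gap (a t u v : R) : 0 <= u -> 0 <= v -> u + v <= 1 ->
  (u = 0 -> a = 0) -> (v = 0 -> t = 0) ->
  (a + t) ^+ 2 / (u + v) + 2 * `|a * t| - 2 * (a * t) <= a ^+ 2 / u + t ^+ 2 / v.
Proof.
move=> u0 v0 uv ua vt.
have [/eqP u00|un] := boolP (u == 0).
  by rewrite u00 ua// !add0r !mul0r normr0 expr0n /= mul0r mulr0 !add0r subr0 addr0.
have [/eqP v00|vn] := boolP (v == 0).
  by rewrite v00 vt// !addr0 !mulr0 normr0 expr0n /= mul0r mulr0 !subr0 !addr0.
have {u0 ua}up : 0 < u by rewrite lt_def un.
have {v0 vt}vp : 0 < v by rewrite lt_def vn.
rewrite -subr_ge0.
have -> : a ^+ 2 / u + t ^+ 2 / v -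
    ((a + t) ^+ 2 / (u + v) + 2 * `|a * t| - 2 * (a * t)) =
    ((a * v - t * u) ^+ 2 - (2 * `|a * t| - 2 * (a * t)) * (u * v * (u + v)))
      / (u * v * (u + v)).
  by field; apply/and3P; split => //; apply/eqP; lra.
apply: divr_ge0; last by rewrite !mulr_ge0// ?addr_ge0// ltW.
have uv0 : 0 <= u * v by rewrite mulr_ge0// ltW.
have [at0|at0] := lerP 0 (a * t).
  by rewrite ger0_norm// subrr mul0r subr0 sqr_ge0.
rewrite ltr0_norm//.
(* With a t < 0 the numerator equals (a v + t u)^2 - 4 a t u v (1 - (u + v)); this is where u + v <=
   1 enters. *)
have : 0 <= (a * v + t * u) ^+ 2 by rewrite sqr_ge0.
have : 0 <= (- (a * t) * (u * v)) * (1 - (u + v)).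
  by rewrite mulr_ge0//; [rewrite mulr_ge0//; lra|lra].
nra.
Qed.

(** [a] and [t] will be the inner products of a test vector with two orthogonal parts of the
    residual of the pivot, [u] and [v] the squared norms of these parts. Dropping the second part is
    paid for by t^2 / v, a squared projection length. *)
Lemma sign_mgf_exchange z a t u v : -1 <= z <= 1 ->
  0 <= u -> 0 <= v -> u + v <= 1 -> (u = 0 -> a = 0) -> (v = 0 -> t = 0) ->
  sign_mgf z (a + t) * expR (4 * ((a + t) ^+ 2 / (u + v) - (a + t) ^+ 2)) <=
  sign_mgf z a * expR (4 * (a ^+ 2 / u - a ^+ 2)) * expR (4 * (t ^+ 2 / v)).
Proof.
move=> zP u0 v0 uv ua vt.
apply: (@le_trans _ _ (sign_mgf z a * expR (4 * (t ^+ 2 + 2 * `|a * t|)) *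
   expR (4 * ((a + t) ^+ 2 / (u + v) - (a + t) ^+ 2)))).
  by rewrite ler_wpM2r ?expR_ge0// sign_mgf_shift.
have := le_trans ler01 (sign_mgf_ge1 a zP); move: (sign_mgf z a) => S S0.
have := cauchy_gap u0 v0 uv ua vt.
have : (a + t) ^+ 2 = a ^+ 2 + 2 * (a * t) + t ^+ 2 by ring.
move: (a ^+ 2 / u) (t ^+ 2 / v) (_ / (u + v)) `|a * t| => x y w s sq gap.
rewrite -mulrA -expRD -[leRHS]mulrA -expRD ler_wpM2l// ler_expR.
lra.
Qed.

End SignMgf.

(** * The Gram-Schmidt walk *)

Section Dot.
Variables (R : realType) (N : nat).
Implicit Types (u v : 'rV[R]_N) (P : 'M[R]_N).

Definition dot u v : R := (u *m v^T) 0 0.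

Lemma dotE u v : dot u v = \sum_i u 0 i * v 0 i.
Proof. by rewrite /dot mxE; apply: eq_bigr => i _; rewrite mxE. Qed.

Lemma dotC u v : dot u v = dot v u.
Proof. by rewrite !dotE; apply: eq_bigr => i _; rewrite mulrC. Qed.

Lemma dotDl u u' v : dot (u + u') v = dot u v + dot u' v.
Proof. by rewrite /dot mulmxDl mxE. Qed.

Lemma dotBl u u' v : dot (u - u') v = dot u v - dot u' v.
Proof. by rewrite /dot mulmxBl mxE [X in _ + X]mxE. Qed.

Lemma dotZl a u v : dot (a *: u) v = a * dot u v.
Proof. by rewrite /dot -scalemxAl mxE. Qed.

Lemma dot0l v : dot 0 v = 0.
Proof. by rewrite /dot mul0mx mxE. Qed.

Lemma dotDr u v v' : dot u (v + v') = dot u v + dot u v'.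
Proof. by rewrite ![dot u _]dotC dotDl. Qed.

Lemma dotBr u v v' : dot u (v - v') = dot u v - dot u v'.
Proof. by rewrite ![dot u _]dotC dotBl. Qed.

Lemma dotZr a u v : dot u (a *: v) = a * dot u v.
Proof. by rewrite ![dot u _]dotC dotZl. Qed.

Lemma dotvv_ge0 u : 0 <= dot u u.
Proof. by rewrite dotE; apply: sumr_ge0 => i _; rewrite -expr2 sqr_ge0. Qed.

Lemma dotvv_eq0 u : dot u u = 0 -> u = 0.
Proof.
rewrite dotE => /eqP; rewrite psumr_eq0 => [/allP u0|i _]; last first.
  by rewrite -expr2 sqr_ge0.
apply/rowP => i; apply/eqP; rewrite mxE -sqrf_eq0 expr2.
by apply: u0; rewrite mem_index_enum.
Qed.

Lemma dot_mulmx_sym P u v : P^T = P -> dot (u *m P) v = dot u (v *m P).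
Proof. by move=> sP; rewrite /dot trmx_mul sP mulmxA. Qed.

Lemma rank1_mulmx u v : u *m (v^T *m v) = dot u v *: v.
Proof. by rewrite mulmxA [u *m _]mx11_scalar mul_scalar_mx. Qed.

End Dot.

(** * Orthogonal projections onto the span of a set of vectors *)

Section Projection.
Variables (R : realType) (n N : nat) (w : 'M[R]_(n, N)).
Implicit Types (B : {set 'I_n}) (P : 'M[R]_N).

(** Rows outside [B] are zeroed, so that the type does not depend on [B]; the row space is the span
    of the vectors indexed by [B]. *)
Definition rows_in B : 'M[R]_(n, N) :=
  \matrix_k (if k \in B then row k w else 0).

(** These conditions determine the orthogonal projection onto the span ([orthproj_uniq]), also for
    linearly dependent rows, whose Gram matrix is singular. *)
Definition orthproj B P :=
  [/\ P^T = P, (P <= rows_in B)%MS & forall k, k \in B -> row k w *m P = row k w].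

Lemma rows_in_mul B P : orthproj B P -> rows_in B *m P = rows_in B.
Proof.
case=> _ _ fixP; apply/row_matrixP => k; rewrite row_mul rowK.
by case: ifP => [/fixP//|_]; rewrite mul0mx.
Qed.

Lemma orthproj_absorb B P P' : orthproj B P -> orthproj B P' -> P' *m P = P'.
Proof.
move=> oP [_ /submxP[C ->] _].
by rewrite -mulmxA rows_in_mul.
Qed.

Lemma orthproj_uniq B P P' : orthproj B P -> orthproj B P' -> P = P'.
Proof.
move=> oP oP'; have := orthproj_absorb oP oP'; have := orthproj_absorb oP' oP.
case: oP oP' => sP _ _ [sP' _ _] PP' P'P.
by have := congr1 trmx P'P; rewrite trmx_mul sP sP' PP'.
Qed.

Lemma row_in_sub B k : k \in B -> (row k w <= rows_in B)%MS.
Proof.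
move=> kB; have -> : row k w = row k (rows_in B) by rewrite rowK kB.
exact: row_sub.
Qed.

Lemma rows_in_sub B B' : B \subset B' -> (rows_in B <= rows_in B')%MS.
Proof.
move=> BB'; apply/row_subP => k; rewrite rowK; case: ifP => [kB|_].
  by apply: row_in_sub; apply: (fintype.subsetP BB').
exact: sub0mx.
Qed.

Definition residual P (k : 'I_n) : 'rV[R]_N := row k w - row k w *m P.

Lemma residual_orth B P k l : orthproj B P -> l \in B ->
  dot (row l w) (residual P k) = 0.
Proof.
case=> sP _ fixP lB.
by rewrite dotBr -dot_mulmx_sym// fixP// subrr.
Qed.

Lemma residual_mulmx B P k : orthproj B P -> residual P k *m P = 0.
Proof.
by move=> oP; rewrite mulmxBl -mulmxA (orthproj_absorb oP oP) subrr.
Qed.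

Lemma dot_row_residual B P k : orthproj B P ->
  dot (row k w) (residual P k) = dot (residual P k) (residual P k).
Proof.
move=> oP; rewrite [in RHS]dotBl; case: (oP) => sP _ _.
rewrite dot_mulmx_sym// (residual_mulmx _ oP).
by rewrite [dot _ 0]dotC dot0l subr0.
Qed.

(** One Gram-Schmidt step. If row k already lies in the span, then e = 0 and the rank-one term
    vanishes. *)
Lemma orthproj_setU1 B P k : orthproj B P ->
  let e := residual P k in
  orthproj (k |: B) (P + (dot e e)^-1 *: (e^T *m e)).
Proof.
move=> oP e; have [sP subP fixP] := oP; split.
- by rewrite linearD linearZ /= trmx_mul trmxK sP.
- have PB : (P <= rows_in (k |: B))%MS.
    by apply: (submx_trans subP); apply: rows_in_sub; apply: finset.subsetUr.
  apply: addmx_sub => //; apply/scalemx_sub/mulmx_sub/addmx_sub.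
    by apply: row_in_sub; rewrite !inE eqxx.
  by rewrite eqmx_opp mulmx_sub.
move=> l; rewrite !inE mulmxDr -scalemxAr rank1_mulmx => /predU1P[->|lB].
  rewrite (dot_row_residual k oP) -/e scalerA.
  have [/eqP e0|e0] := boolP (dot e e == 0).
    by move: (dotvv_eq0 e0) => /eqP; rewrite e0 mulr0 scale0r addr0 subr_eq0 => /eqP.
  by rewrite mulVf// scale1r addrC subrK.
by rewrite (residual_orth k oP lB) scale0r scaler0 addr0 fixP.
Qed.

Lemma orthproj_exists B : exists P, orthproj B P.
Proof.
have [m] := ubnP #|B|; elim: m B => // m IH B Bm.
have [->|[k kB]] := set_0Vmem B.
  exists 0; split; first by rewrite trmx0.
    exact: sub0mx.
  by move=> k; rewrite inE.
have [|P oP] := IH (B :\ k); first by move: Bm; rewrite (cardsD1 k) kB ltnS.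
by rewrite -(finset.setD1K kB); eexists; apply: orthproj_setU1 oP.
Qed.

End Projection.

(** * Invariants of the walk and their induction *)

Section GramSchmidtWalk.
Variables (R : realType) (n N : nat) (w : 'M[R]_(n, N)).
Hypothesis w_le1 : forall k, dot (row k w) (row k w) <= 1.
Implicit Types (B : {set 'I_n}) (P : 'M[R]_N) (z : 'rV[R]_n) (p : 'I_n).

Definition signs (x : {ffun 'I_n -> bool}) : 'rV[R]_n := \row_k (-1) ^+ x k.

Definition distr (mu : {ffun 'I_n -> bool} -> R) :=
  (forall x, 0 <= mu x) /\ \sum_x mu x = 1.

Definition walk_mgf (mu : {ffun 'I_n -> bool} -> R) z (t : 'rV[R]_N) : R :=
  \sum_x mu x * expR (dot ((signs x - z) *m w) t).

Definition in_cube z := forall k, -1 <= z 0 k <= 1.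
Definition frozen z k := z 0 k = 1 \/ z 0 k = -1.

(** The walk is never run as a random process: a bound asserts that a suitable law of the final
    signs exists when the walk stands at [z], and such laws are mixed backwards from the vertices of
    the cube. Here no pivot is chosen yet. *)
Definition alive_bound B z := forall P, orthproj w B P ->
  exists2 mu, distr mu & forall t,
    walk_mgf mu z t <= expR (4 * dot (t *m P) t).

(* B is the set of coordinates that may still move, besides the pivot p. Since
   e^{z t} sign_mgf z t is affine in z, the bound is preserved exactly by
   centered moves of the pivot along the residual; when a coordinate of B
   freezes, it is preserved by sign_mgf_exchange. *)
Definition pivot_bound B p z := forall P, orthproj w B P ->
  let r := residual w P p in
  exists2 mu, distr mu & forall t,
    walk_mgf mu z t <= expR (4 * dot (t *m P) t) *
      (sign_mgf (z 0 p) (dot r t) *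
       expR (4 * (dot r t ^+ 2 / dot r r - dot r t ^+ 2))).

Lemma residual_sqnorm_le1 B P p : orthproj w B P ->
  dot (residual w P p) (residual w P p) <= 1.
Proof.
move=> oP; apply: le_trans (w_le1 p).
rewrite -(dot_row_residual p oP) dotBr gerBl.
have [sP _ _] := oP.
rewrite -(orthproj_absorb oP oP) mulmxA [dot _ (_ *m P)]dotC.
by rewrite dot_mulmx_sym// dotvv_ge0.
Qed.

Lemma sqr_dot_residual_le B P p t : orthproj w B P ->
  dot (residual w P p) t ^+ 2 <=
  dot (residual w P p) t ^+ 2 / dot (residual w P p) (residual w P p).
Proof.
move=> oP; set r := residual w P p; have := residual_sqnorm_le1 p oP; rewrite -/r => r1.
have [/eqP/dotvv_eq0 ->|r0] := boolP (dot r r == 0).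
  by rewrite !dot0l expr0n /= mul0r.
by rewrite ler_peMr ?sqr_ge0// invf_ge1// lt_def r0 dotvv_ge0.
Qed.

Lemma alive_bound0 z : (forall k, frozen z k) -> alive_bound finset.set0 z.
Proof.
move=> fz P oP.
have {oP} P0 : P = 0.
  case: oP => _ + _; have -> : rows_in w finset.set0 = 0.
    by apply/row_matrixP => k; rewrite rowK inE row0.
  exact: submx0null.
pose x0 : {ffun 'I_n -> bool} := [ffun k => z 0 k == -1].
have zx : signs x0 = z.
  apply/rowP => k; rewrite mxE ffunE; case: (fz k) => ->; last by rewrite eqxx expr1.
  by rewrite -subr_eq0 opprK -(natrD _ 1 1) pnatr_eq0 expr0.
exists (fun x => (x == x0)%:R); first split.
- by move=> x; rewrite ler0n.
- by rewrite (bigD1 x0)//= eqxx big1 ?addr0// => x /negPf ->.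
move=> t; rewrite P0 mulmx0 dot0l mulr0 expR0 /walk_mgf (bigD1 x0)//= eqxx.
rewrite big1 => [|x /negPf ->]; last by rewrite mul0r.
by rewrite addr0 mul1r zx subrr mul0mx dot0l expR0.
Qed.

(** For a pivot that has just frozen: its factor in [pivot_bound] is at least 1, so the bound
    without it is stronger. *)
Lemma pivot_bound_frozen_pivot B p z :
  in_cube z -> alive_bound B z -> pivot_bound B p z.
Proof.
move=> zc S0 P oP r; have [mu dmu mub] := S0 P oP.
exists mu => [//|t]; apply: (le_trans (mub t)).
rewrite ler_peMr ?expR_ge0//.
rewrite -[leLHS]mulr1 ler_pM// ?sign_mgf_ge1//.
rewrite -[leLHS]expR0 ler_expR.
by have := sqr_dot_residual_le p t oP; rewrite -/r => ?; lra.
Qed.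

(** Freezing k takes its vector out of the span: with e the residual of row k, the projection loses
    its component along e, and the residual of the pivot gains b e, orthogonal to r.
    [sign_mgf_exchange] balances the two. *)
Lemma pivot_bound_frozen B p z k : in_cube z -> k \in B ->
  pivot_bound (B :\ k) p z -> pivot_bound B p z.
Proof.
move=> zc kB S1 P oP r.
have [P' oP'] := orthproj_exists w (B :\ k).
have [mu dmu mub] := S1 P' oP'; exists mu => [//|t]; apply: (le_trans (mub t)).
pose e := residual w P' k; pose c := (dot e e)^-1.
have PE : P = P' + c *: (e^T *m e).
  apply: (orthproj_uniq oP); rewrite -(finset.setD1K kB).
  exact: orthproj_setU1 oP'.
pose b := c * dot (row p w) e.
set r' := residual w P' p.
have rr' : r' = r + b *: e.
  rewrite /r /residual PE mulmxDr -scalemxAr rank1_mulmx scalerA -/b.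
  by rewrite opprD addrA subrK.
have ee0 : dot e e = 0 -> e = 0 by exact: dotvv_eq0.
have re : dot r e = 0.
  rewrite /r /residual PE mulmxDr -scalemxAr rank1_mulmx.
  rewrite scalerA -/b opprD addrA dotBl dotZl.
  have -> : dot (row p w - row p w *m P') e = dot (row p w) e.
    rewrite dotBl; case: (oP') => sP' _ _; rewrite dot_mulmx_sym//.
    by rewrite /e (residual_mulmx k oP') [dot _ 0]dotC dot0l subr0.
  rewrite /b /c; have [/eqP/ee0 ->|e0] := boolP (dot e e == 0).
    by rewrite [dot _ 0]dotC !dot0l mulr0 subrr.
  by rewrite [_^-1 * _ * _]mulrAC mulVf// mul1r subrr.
have r'1 : dot r' r' <= 1 by exact: residual_sqnorm_le1 p oP'.
clearbody r r' e b.
have rr'2 : dot r' r' = dot r r + b ^+ 2 * dot e e.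
  rewrite rr' dotDl !dotDr !dotZl !dotZr [dot e r]dotC re; ring.
have rt' : dot r' t = dot r t + b * dot e t by rewrite rr' dotDl dotZl.
have tPt : dot (t *m P) t = dot (t *m P') t + c * dot e t ^+ 2.
  rewrite PE mulmxDr -scalemxAr rank1_mulmx dotDl !dotZl [dot t e]dotC expr2.
  by ring.
rewrite tPt [4 * (_ + c * _)]mulrDr expRD -[leRHS]mulrA ler_wpM2l ?expR_ge0//.
rewrite [leRHS]mulrC rr'2 rt'.
apply: le_trans (sign_mgf_exchange (zc p) _ _ _ _ _) _.
- exact: dotvv_ge0.
- by rewrite mulr_ge0 ?sqr_ge0 ?dotvv_ge0.
- by rewrite -rr'2.
- by move=> /dotvv_eq0 ->; rewrite dot0l.
- move=> /eqP; rewrite mulf_eq0 sqrf_eq0 => /orP[/eqP ->|/eqP/ee0 ->].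
    by rewrite mul0r.
  by rewrite dot0l mulr0.
rewrite ler_wpM2l//.
  by rewrite mulr_ge0 ?expR_ge0// (le_trans ler01)// sign_mgf_ge1.
rewrite ler_expR ler_wpM2l// /c.
have [/eqP/ee0 ->|e0] := boolP (dot e e == 0).
  by rewrite !dot0l mulr0 expr0n /= mul0r mulr0.
have [/eqP ->|b0] := boolP (b == 0).
  by rewrite mul0r expr0n /= mul0r mulr_ge0 ?sqr_ge0// invr_ge0 dotvv_ge0.
by rewrite le_eqVlt; apply/orP; left; apply/eqP; field; rewrite e0 b0.
Qed.

(** The reason for the last factor in [pivot_bound]: after [sign_mgf_le], the pivot contributes e^{4
    <e, t>^2 / |e|^2}, exactly what its direction adds to the enlarged projection. *)
Lemma alive_bound_pivot B p z : in_cube z -> p \notin B ->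
  pivot_bound B p z -> alive_bound (p |: B) z.
Proof.
move=> zc pB S1 P oP.
have [P' oP'] := orthproj_exists w B.
have [mu dmu mub] := S1 P' oP'; exists mu => [//|t]; apply: (le_trans (mub t)).
pose e := residual w P' p.
have -> : P = P' + (dot e e)^-1 *: (e^T *m e).
  by apply: (orthproj_uniq oP); exact: orthproj_setU1 oP'.
rewrite -/e; clearbody e.
rewrite mulmxDr -scalemxAr rank1_mulmx dotDl !dotZl [dot t e]dotC.
rewrite [4 * (_ + _ * (_ * _))]mulrDr expRD ler_wpM2l ?expR_ge0//.
apply: (@le_trans _ _ (expR (4 * dot e t ^+ 2) *
    expR (4 * (dot e t ^+ 2 / dot e e - dot e t ^+ 2)))).
  by rewrite ler_wpM2r ?expR_ge0// sign_mgf_le.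
by rewrite -expRD ler_expR le_eqVlt; apply/orP; left; apply/eqP; ring.
Qed.

Lemma cube_exit z (v : 'rV[R]_n) p : v 0 p != 0 ->
  (forall k, v 0 k != 0 -> -1 < z 0 k < 1) -> in_cube z ->
  exists2 d, 0 < d & in_cube (z + d *: v) /\
    exists2 k, v 0 k != 0 & frozen (z + d *: v) k.
Proof.
move=> vp za zc.
(* The time at which coordinate k, moving at velocity [v 0 k], reaches a face of the cube; the
   earliest one is taken. *)
pose F k := (1 - Num.sg (v 0 k) * z 0 k) / `|v 0 k|.
pose k0 := [arg min_(k < p | v 0 k != 0) F k]%O.
have [vk0 k0P] : v 0 k0 != 0 /\ forall k, v 0 k != 0 -> F k0 <= F k.
  by rewrite /k0; case: arg_minP.
have sgz k : v 0 k != 0 -> -1 < Num.sg (v 0 k) * z 0 k < 1.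
  move=> vk; have /andP[z1 z2] := za k vk.
  by case: sgrP vk => //; rewrite ?eqxx// => _ _; apply/andP; split; lra.
have F0 k : v 0 k != 0 -> 0 < F k.
  by move=> vk; rewrite divr_gt0 ?normr_gt0//; have /andP[] := sgz k vk; lra.
exists (F k0); first exact: F0.
split.
  move=> k; rewrite mxE [X in _ + X]mxE.
  have [->|vk] := eqVneq (v 0 k) 0; first by rewrite mulr0 addr0 zc.
  have := k0P k vk; have := F0 k0 vk0; move: (F k0) => d d0.
  rewrite /F ler_pdivlMr ?normr_gt0// => dk.
  have /andP[z1 z2] := za k vk.
  have dv : 0 < d * `|v 0 k| by rewrite mulr_gt0 ?normr_gt0.
  by move: dk dv; case: sgrP vk => //; rewrite ?eqxx// => _ _ dk dv;
    apply/andP; split; lra.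
exists k0 => //; rewrite /frozen mxE [X in _ + X]mxE /F.
move: vk0; case: sgrP => //; rewrite ?eqxx// => v0 vn; [left|right]; field;
  by rewrite ?(gt_eqF v0) ?(lt_eqF v0).
Qed.

Lemma walk_mgf_mix mu nu z (v : 'rV[R]_n) a b t : 0 < a -> 0 < b ->
  walk_mgf (fun x => b / (a + b) * mu x + a / (a + b) * nu x) z t =
  b / (a + b) * (expR (a * dot (v *m w) t) * walk_mgf mu (z + a *: v) t) +
  a / (a + b) * (expR (- b * dot (v *m w) t) * walk_mgf nu (z + (- b) *: v) t).
Proof.
move=> a0 b0; rewrite /walk_mgf.
have shift c x : expR (dot ((signs x - z) *m w) t) =
    expR (c * dot (v *m w) t) * expR (dot ((signs x - (z + c *: v)) *m w) t).
  rewrite -expRD; congr expR.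
  rewrite opprD addrA [in RHS]mulmxBl [in RHS]dotBl -scalemxAl dotZl; ring.
rewrite !big_distrr /= -big_split /=; apply: eq_bigr => x _.
by rewrite mulrDl {1}(shift a) (shift (- b)); congr (_ + _); ring.
Qed.

Lemma distr_mix mu nu a b : 0 < a -> 0 < b -> distr mu -> distr nu ->
  distr (fun x => b / (a + b) * mu x + a / (a + b) * nu x).
Proof.
move=> a0 b0 [mu0 mu1] [nu0 nu1]; split.
  by move=> x; rewrite addr_ge0// mulr_ge0// divr_ge0// ?addr_ge0// ltW.
rewrite big_split /= -!big_distrr /= mu1 nu1 !mulr1 -mulrDl addrC divff//.
by rewrite gt_eqF// addr_gt0.
Qed.

(** Along v the pivot moves at unit speed while the vector sum moves along r, so the same number <r,
    t> drives e^{a <r, t>} and [sign_mgf]. Their product is affine in the step, and the weights b /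
    (a + b) and a / (a + b) make the mean step zero. *)
Lemma pivot_bound_move B p z (v : 'rV[R]_n) a b P : orthproj w B P ->
  v 0 p = 1 -> v *m w = residual w P p -> 0 < a -> 0 < b ->
  pivot_bound B p (z + a *: v) -> pivot_bound B p (z + (- b) *: v) ->
  pivot_bound B p z.
Proof.
move=> oP vp vw a0 b0 Sa Sb P' oP' r.
rewrite -{P' oP'}(orthproj_uniq oP oP') in r *.
have [mu dmu mub] := Sa P oP; have [nu dnu nub] := Sb P oP.
eexists; first exact: (distr_mix a0 b0 dmu dnu).
move=> t; rewrite (walk_mgf_mix _ _ _ v)// vw -/r.
set x := dot r t; set E := expR (4 * dot (t *m P) t).
set Q := expR (4 * (x ^+ 2 / dot r r - x ^+ 2)).
pose H y := (1 + y) / 2 * expR x + (1 - y) / 2 * expR (- x).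
have hH c : expR (c * x) * sign_mgf ((z + c *: v) 0 p) x =
    expR (- (z 0 p * x)) * H (z 0 p + c).
  rewrite /sign_mgf mxE [X in _ + X]mxE vp mulr1 mulrA -expRD -/(H _).
  by congr (expR _ * _); ring.
apply: (@le_trans _ _ (b / (a + b) * (E * (expR (- (z 0 p * x)) * H (z 0 p + a) * Q)) +
   a / (a + b) * (E * (expR (- (z 0 p * x)) * H (z 0 p + - b) * Q)))).
  apply: lerD; apply: ler_wpM2l; rewrite ?divr_ge0 ?addr_ge0 ?(ltW a0) ?(ltW b0)//.
    apply: (@le_trans _ _ (expR (a * x) * (E * (sign_mgf ((z + a *: v) 0 p) x * Q)))).
      by rewrite ler_wpM2l ?expR_ge0//; exact: mub.
    by rewrite -hH le_eqVlt; apply/orP; left; apply/eqP; ring.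
  apply: (@le_trans _ _ (expR (- b * x) * (E * (sign_mgf ((z + (- b) *: v) 0 p) x * Q)))).
    by rewrite ler_wpM2l ?expR_ge0//; exact: nub.
  by rewrite -hH le_eqVlt; apply/orP; left; apply/eqP; ring.
rewrite le_eqVlt; apply/orP; left; apply/eqP.
rewrite /sign_mgf /H; field; apply/eqP; lra.
Qed.

Lemma pivot_boundP B p z : in_cube z -> p \notin B ->
  (forall k, k \notin p |: B -> frozen z k) ->
  (forall z', in_cube z' -> (forall k, k \notin B -> frozen z' k) ->
    alive_bound B z') ->
  (forall k z', k \in B -> in_cube z' ->
    (forall l, l \notin p |: (B :\ k) -> frozen z' l) ->
    pivot_bound (B :\ k) p z') ->
  pivot_bound B p z.
Proof.
move=> zc pB zf S0 S1.
have stuck z' k : in_cube z' -> (forall l, l \notin p |: B -> frozen z' l) ->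
    k \in p |: B -> frozen z' k -> pivot_bound B p z'.
  move=> zc' zf' kpB fk; move: (kpB); rewrite !inE => /predU1P[kp|kB].
    apply: pivot_bound_frozen_pivot => //; apply: S0 => // l lB.
    have [->|lp] := eqVneq l p; first by rewrite -kp.
    by apply: zf'; rewrite !inE negb_or lp.
  apply: (pivot_bound_frozen zc' kB); apply: S1 => // l.
  rewrite !inE negb_or negb_and negbK => /andP[lp /predU1P[->//|lB]].
  by apply: zf'; rewrite !inE negb_or lp.
have [[k kpB fk]|nf] := pselect (exists2 k, k \in p |: B & frozen z k).
  exact: stuck kpB fk.
have {nf} za k : k \in p |: B -> -1 < z 0 k < 1.
  move=> kpB; have /andP[z1 z2] := zc k; apply/andP; split; rewrite lt_def ?z1 ?z2 andbT;
    apply/negP => /eqP e; apply: nf; exists k => //; [by right|by left].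
have [P oP] := orthproj_exists w B; have [_ subP _] := oP.
have /submxP[C wpP] : (row p w *m P <= rows_in w B)%MS by exact: mulmx_sub.
(* The coordinates of [B] move so as to cancel the projection of row p onto their span, which makes
   [v *m w] the residual. *)
pose v : 'rV[R]_n := delta_mx 0 p - \row_k (if k \in B then C 0 k else 0).
have vp : v 0 p = 1 by rewrite !mxE !eqxx (negPf pB) subr0.
have vw : v *m w = residual w P p.
  rewrite /residual mulmxBl -rowE wpP; congr (_ - _).
  apply/rowP => i; rewrite !mxE; apply: eq_bigr => k _; rewrite !mxE.
  by case: ifP => _; rewrite ?mul0r ?mxE ?mulr0.
have vsupp k : v 0 k != 0 -> k \in p |: B.
  rewrite !inE !mxE eqxx /=; case: (eqVneq k p) => //= _.
  by case: (k \in B) => //; rewrite subrr eqxx.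
have vsuppN k : k \notin p |: B -> v 0 k = 0.
  by apply: contraNeq => /vsupp.
have keep c l : l \notin p |: B -> frozen (z + c *: v) l.
  by move=> lB; rewrite /frozen mxE [X in _ + X]mxE vsuppN// mulr0 addr0; exact: zf.
have vz k : v 0 k != 0 -> -1 < z 0 k < 1 by move/vsupp/za.
have [|a a0 [ca [k vk fk]]] := @cube_exit z v p _ vz zc.
  by rewrite vp oner_neq0.
have [||b b0 [cb [l vl fl]]] := @cube_exit z (- v) p _ _ zc.
- by rewrite mxE vp oppr_eq0 oner_neq0.
- by move=> l; rewrite mxE oppr_eq0; exact: vz.
rewrite scalerN -scaleNr in cb fl.
apply: (pivot_bound_move oP vp vw a0 b0).
  by apply: (stuck _ k) => //; [exact: keep|exact: vsupp].
apply: (stuck _ l) => //; first exact: keep.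
by apply: vsupp; move: vl; rewrite mxE oppr_eq0.
Qed.

(** Two nested inductions: the outer one, on the number of live coordinates, serves when the pivot
    freezes; the inner one, on [B] with the pivot kept, when another coordinate does. *)
Lemma alive_boundP m B z : (#|B| <= m)%N -> in_cube z ->
  (forall k, k \notin B -> frozen z k) -> alive_bound B z.
Proof.
have [m1] := ubnP m; elim: m1 m B z => // m1 IH m B z mm1 Bm zc zf.
have [B0|[p pB]] := set_0Vmem B.
  by rewrite B0; apply: alive_bound0 => k; apply: zf; rewrite B0 inE.
have B1 : (#|B :\ p| < m)%N by move: Bm; rewrite (cardsD1 p) pB.
rewrite -(finset.setD1K pB).
have pB1 : p \notin B :\ p by rewrite !inE eqxx.
apply: alive_bound_pivot => //.
have {}zf k : k \notin p |: (B :\ p) -> frozen z k by rewrite finset.setD1K//; exact: zf.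
move: (B :\ p) pB1 B1 zf => {pB Bm}B pB Bm zf.
have [m2] := ubnP #|B|; elim: m2 B z pB Bm zc zf => // m2 IH2 B z pB Bm zc zf Bm2.
apply: pivot_boundP => // [z' zc' zf'|k z' kB zc' zf'].
  by apply: (IH #|B|) => //; apply: leq_trans Bm _; rewrite -ltnS.
have Bk : (#|B :\ k| < #|B|)%N by rewrite [in ltnRHS](cardsD1 k) kB.
apply: IH2 => //; first by rewrite !inE negb_and pB orbT.
  exact: ltn_trans Bk Bm.
exact: leq_trans Bk _.
Qed.

Theorem gram_schmidt_walk : exists2 mu, distr mu & forall t,
  \sum_x mu x * expR (dot (signs x *m w) t) <= expR (4 * dot t t).
Proof.
have [P oP] := orthproj_exists w [set: 'I_n].
have [|||mu dmu mub] := @alive_boundP n [set: 'I_n] 0 _ _ _ P oP.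
- by rewrite cardsT card_ord.
- by move=> k; rewrite mxE; apply/andP; split; lra.
- by move=> k; rewrite inE.
exists mu => // t.
have -> : \sum_x mu x * expR (dot (signs x *m w) t) = walk_mgf mu 0 t.
  by apply: eq_bigr => x _; rewrite subr0.
apply: (le_trans (mub t)); rewrite ler_expR ler_wpM2l//.
rewrite -subr_ge0 -dotBl.
have [sP _ _] := oP; have PP := orthproj_absorb oP oP.
have -> : dot (t - t *m P) t = dot (t - t *m P) (t - t *m P).
  rewrite [RHS]dotBr -(dot_mulmx_sym (t - t *m P) t sP) mulmxBl -mulmxA PP.
  by rewrite subrr dot0l subr0.
exact: dotvv_ge0.
Qed.

End GramSchmidtWalk.

(** * Subgaussian weights *)

Section Subgaussian.
Variables (R : realType) (T : finType) (mu : T -> R).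
Hypotheses (mu_ge0 : forall x, 0 <= mu x) (mu_sum1 : \sum_x mu x = 1).
Implicit Type Y : T -> R.

(** [V] is half the usual variance proxy. *)
Definition subgaussian (V : R) Y :=
  forall l : R, \sum_x mu x * expR (l * Y x) <= expR (l ^+ 2 * V).

Lemma subgaussianW V V' Y : V <= V' -> subgaussian V Y -> subgaussian V' Y.
Proof.
move=> VV' sY l; apply: (le_trans (sY l)).
by rewrite ler_expR ler_wpM2l ?sqr_ge0.
Qed.

Lemma subgaussian_abs V Y l : 0 <= l -> subgaussian V Y ->
  \sum_x mu x * expR (l * `|Y x|) <= 2 * expR (l ^+ 2 * V).
Proof.
move=> l0 sY.
apply: (@le_trans _ _ (\sum_x mu x * expR (l * Y x) + \sum_x mu x * expR (- l * Y x))).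
  rewrite -big_split /=; apply: ler_sum => x _.
  rewrite -mulrDr ler_wpM2l// mulNr.
  have [y0|y0] := ger0P (Y x).
    by rewrite lerDl expR_ge0.
  by rewrite mulrN lerDr expR_ge0.
have := sY l; have := sY (- l); rewrite sqrrN; lra.
Qed.

Lemma subgaussian_tail V Y a : 0 < V -> 0 <= a -> subgaussian V Y ->
  \sum_(x | a < `|Y x|) mu x <= 2 * expR (- (a ^+ 2 / (4 * V))).
Proof.
move=> V0 a0 sY; set l := a / (2 * V).
have l0 : 0 <= l by rewrite divr_ge0// mulr_ge0// ltW.
have e0 := expR_gt0 (l * a).
rewrite -(ler_pM2r e0) -[leRHS]mulrA -expRD.
have -> : - (a ^+ 2 / (4 * V)) + l * a = l ^+ 2 * V.
  by rewrite /l; field; rewrite gt_eqF.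
apply: le_trans (subgaussian_abs l0 sY).
rewrite big_distrl /= [leRHS](bigID (fun x => a < `|Y x|)) /=.
rewrite -[leLHS]addr0; apply: lerD; last first.
  by apply: sumr_ge0 => x _; rewrite mulr_ge0 ?expR_ge0.
by apply: ler_sum => x /ltW xa; rewrite ler_wpM2l// ler_expR ler_wpM2l.
Qed.

(** The chord bound for a convex function. It will turn a constant bound on the mean of e^{Y^2 / 8}
    into a bound 1 + O(s) on that of e^{s Y^2}. *)
Lemma expR_interpolate (d u : R) : 0 <= d <= 1 ->
  expR (d * u) <= 1 + d * (expR u - 1).
Proof.
move=> /andP[d0 d1].
have -> : expR u = expR (d * u) * expR ((1 - d) * u).
  by rewrite -expRD; congr expR; ring.
have : expR (d * u) * expR (- (d * u)) = 1 by rewrite expRxMexpNx_1.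
have := expR_ge1Dx (- (d * u)); have := expR_ge1Dx ((1 - d) * u).
have := expR_gt0 (d * u).
move: (expR (d * u)) (expR ((1 - d) * u)) (expR (- (d * u))) => A B C A0 Bge Cge AC.
have : 0 <= A * (d * (B - (1 + (1 - d) * u))).
  by apply: mulr_ge0; [exact: ltW|apply: mulr_ge0; lra].
have : 0 <= A * ((1 - d) * (C - (1 + - (d * u)))).
  by apply: mulr_ge0; [exact: ltW|apply: mulr_ge0; lra].
have -> : A * ((1 - d) * (C - (1 + - (d * u)))) =
  (1 - d) * (A * C) - A * ((1 - d) * (1 + - (d * u))) by ring.
rewrite AC; lra.
Qed.

(* Linearizes the square: (y - j)^2 <= 1 for j = truncn y. *)
Lemma expR_truncn_le (y : R) : 0 <= y ->
  expR (y ^+ 2 / 8) <= expR 8^-1 * expR (- ((Num.truncn y)%:R ^+ 2 / 8)) *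
    expR ((Num.truncn y)%:R / 4 * y).
Proof.
move=> y0; set j : R := (Num.truncn y)%:R; have /andP[] := truncn_itv y0;
rewrite -/j -natr1 -/j => j1 j2.
rewrite -!expRD ler_expR; nra.
Qed.

Lemma subgaussian1_sqr Y : subgaussian 1 Y ->
  \sum_x mu x * expR (Y x ^+ 2 / 8) <= 39.
Proof.
move=> sY; pose J := (\max_x Num.truncn `|Y x|).+1.
pose c : R := expR 8^-1.
have c1 : c <= 8 / 7.
  apply: le_trans (expR_le_inv1B _) _; first lra.
  by rewrite -[leLHS]mul1r ler_pdivrMr; lra.
(* The value of truncn |Y x| is replaced by a sum over all j; the exponents - j^2 / 8 + j^2 / 16
   then leave a geometric series of ratio q = e^{-1/16}. *)
apply: (@le_trans _ _ (\sum_(j < J) \sum_x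
    c * expR (- (j%:R ^+ 2 / 8)) * (mu x * expR (j%:R / 4 * `|Y x|)))).
  rewrite exchange_big /=; apply: ler_sum => x _.
  have jJ : (Num.truncn `|Y x| < J)%N by rewrite ltnS leq_bigmax.
  rewrite (bigD1 (Ordinal jJ))//= -[leLHS]addr0; apply: lerD.
    rewrite mulrCA ler_wpM2l// -real_normK ?num_real//.
    exact: expR_truncn_le.
  by apply: sumr_ge0 => j _; rewrite !mulr_ge0 ?expR_ge0.
pose q : R := expR (- 16^-1).
have q0 : 0 <= q by exact: expR_ge0.
have q1 : q <= 16 / 17.
  have := expRxMexpNx_1 (16^-1 : R); have := expR_ge1Dx (16^-1 : R).
  by rewrite -/q; move: (expR _) => e; nra.
apply: (@le_trans _ _ (\sum_(j < J) 2 * c * q ^+ j)).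
  apply: ler_sum => j _; rewrite -big_distrr /=.
  apply: (@le_trans _ _ (c * expR (- (j%:R ^+ 2 / 8)) *
      (2 * expR ((j%:R / 4) ^+ 2 * 1)))).
    by rewrite ler_wpM2l ?mulr_ge0 ?expR_ge0//; exact: subgaussian_abs.
  rewrite mulrACA -expRD [2 * c]mulrC ler_wpM2l ?mulr_ge0 ?expR_ge0//.
  rewrite -expRM_natl ler_expR.
  have : (j%:R : R) <= j%:R ^+ 2.
    by rewrite -natrX ler_nat; case: (nat_of_ord j) => // k; rewrite leq_pmulr.
  lra.
rewrite -big_distrr /=.
have gq : (1 - q) * \sum_(j < J) q ^+ j <= 1.
  rewrite -opprB mulNr -subrX1 opprB lerBlDr lerDl exprn_ge0//.
have s0 : 0 <= \sum_(j < J) q ^+ j by apply: sumr_ge0 => j _; rewrite exprn_ge0.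
have c0 : 0 <= c by exact: expR_ge0.
move: (\sum_(j < J) _) gq s0 => S gq s0.
(* From 1 / (1 - q) <= 17; the total is 2 c S <= 2 (8 / 7) 17 < 39. *)
have S17 : S <= 17 by nra.
nra.
Qed.

Lemma subgaussian_sqr V Y s : 0 < V -> 0 <= s -> 8 * (s * V) <= 1 ->
  subgaussian V Y ->
  \sum_x mu x * expR (s * Y x ^+ 2) <= 1 + 304 * (s * V).
Proof.
move=> V0 s0 sV sY.
pose Z x := Y x / Num.sqrt V.
have V0' : Num.sqrt V != 0 by rewrite sqrtr_eq0 -ltNge.
have sZ : subgaussian 1 Z.
  move=> l; have := sY (l / Num.sqrt V).
  rewrite expr_div_n sqr_sqrtr ?(ltW V0)// divfK ?gt_eqF// mulr1.
  by under eq_bigr do rewrite mulrAC -mulrA.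
have h := subgaussian1_sqr sZ.
(* Interpolation with parameter 8 s V between the exponents 0 and Z^2 / 8; 304 = 8 (39 - 1). *)
apply: (@le_trans _ _ (\sum_x mu x * (1 + 8 * (s * V) * (expR (Z x ^+ 2 / 8) - 1)))).
  apply: ler_sum => x _; rewrite ler_wpM2l//.
  have -> : s * Y x ^+ 2 = 8 * (s * V) * (Z x ^+ 2 / 8).
    by rewrite /Z expr_div_n sqr_sqrtr ?(ltW V0)//; field; rewrite gt_eqF.
  by apply: expR_interpolate; rewrite sV andbT !mulr_ge0// ltW.
under eq_bigr do rewrite mulrDr mulr1 mulrCA mulrBr mulr1.
rewrite big_split /= -big_distrr /= sumrB mu_sum1.
have : 0 <= s * V by rewrite mulr_ge0// ltW.
nra.
Qed.

End Subgaussian.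

Section KomlosDistribution.
Variables (R : realType) (d n : nat) (M : 'M[R]_(d, n)).
Hypothesis M_komlos : forall k, \sum_(i < d) M i k ^+ 2 <= 1.

Definition sign_dot (x y : {ffun 'I_n -> bool}) : R :=
  \sum_k (-1) ^+ x k * (-1) ^+ y k.

Definition sign_image (x : {ffun 'I_n -> bool}) (i : 'I_d) : R :=
  \sum_k M i k * (-1) ^+ x k.

(** The stacked columns have squared norm at most 2, so they are scaled by 1 / sqrt 2, which turns
    the constant 4 of the walk into 8. *)
Lemma komlos_distr : exists2 mu : {ffun 'I_n -> bool} -> R, distr mu &
  forall (a : 'I_n -> R) (b : 'I_d -> R),
  subgaussian mu (8 * (\sum_k a k ^+ 2 + \sum_i b i ^+ 2))
    (fun x => \sum_k a k * (-1) ^+ x k + \sum_i b i * sign_image x i).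
Proof.
have s2 : Num.sqrt 2 != 0 :> R by rewrite sqrtr_eq0 -ltNge.
pose w : 'M[R]_(n, n + d) := (Num.sqrt 2)^-1 *: row_mx 1%:M M^T.
have [k|mu dmu mub] := @gram_schmidt_walk R n (n + d) w.
  rewrite /w linearZ /= dotZl dotZr mulrA -expr2 exprVn sqr_sqrtr//.
  rewrite dotE big_split_ord /=.
  rewrite (bigD1 k)//= big1 => [|l lk]; last first.
    by rewrite !mxE (unsplitK (inl l)) mxE eq_sym (negPf lk) mul0r.
  rewrite !mxE (unsplitK (inl k)) mxE eqxx mulr1 addr0.
  under eq_bigr => i _ do rewrite !mxE (unsplitK (inr i)) mxE -expr2.
  by have := M_komlos k; rewrite mulr1n; lra.
exists mu => // a b l.
pose t : 'rV[R]_(n + d) :=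
  (l * Num.sqrt 2) *: row_mx (\row_k a k) (\row_i b i).
have := mub t.
have -> : 4 * dot t t = l ^+ 2 * (8 * (\sum_k a k ^+ 2 + \sum_i b i ^+ 2)).
  rewrite dotZl dotZr.
  have -> : dot (row_mx (\row_k a k) (\row_i b i)) (row_mx (\row_k a k) (\row_i b i))
      = \sum_k a k ^+ 2 + \sum_i b i ^+ 2.
    rewrite dotE big_split_ord /=; congr (_ + _); apply: eq_bigr => k _.
      by rewrite !mxE (unsplitK (inl k)) mxE expr2.
    by rewrite !mxE (unsplitK (inr k)) mxE expr2.
  transitivity (4 * l ^+ 2 * Num.sqrt 2 ^+ 2 *
    (\sum_k a k ^+ 2 + \sum_i b i ^+ 2)); first by ring.
  by rewrite sqr_sqrtr//; ring.
apply: le_trans; rewrite le_eqVlt; apply/orP; left; apply/eqP.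
apply: eq_bigr => x _; congr (_ * expR _).
rewrite /w /t -scalemxAr dotZl dotZr mulrA mulrCA mulVf// mulr1; congr (_ * _).
rewrite mul_mx_row dotE big_split_ord /=; congr (_ + _).
  by apply: eq_bigr => k _; rewrite !row_mxEl mulmx1 !mxE mulrC.
apply: eq_bigr => i _; rewrite !row_mxEr !mxE mulrC; congr (_ * _).
by apply: eq_bigr => k _; rewrite !mxE mulrC.
Qed.

End KomlosDistribution.

(** * Binomial estimates *)

Lemma expR_ge2 (R : realType) (y : R) : 0 <= y -> 1 + y + y ^+ 2 / 2 <= expR y.
Proof.
move=> y0; rewrite /expR.
have -> : 1 + y + y ^+ 2 / 2 = series (exp_coeff y) 3.
  rewrite /series /= !big_nat_recr//= big_nil /exp_coeff /=.
  by rewrite expr0 expr1 !factS fact0 !divr1 add0r.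
apply: nondecreasing_cvgn_le; last exact: is_cvg_series_exp_coeff.
apply/nondecreasing_seqP => k; rewrite seriesSr lerDl /exp_coeff /=.
by rewrite divr_ge0// exprn_ge0.
Qed.

(** (1 + x) / (1 - x) will be the ratio of consecutive binomial coefficients, and e^{2 x} that of
    consecutive Gaussian values. With [expR_cayley_ge] they agree up to a cubic error in the
    exponent. *)
Lemma expR_cayley (R : realType) (x : R) : 0 <= x ->
  (1 - x) * expR (2 * x) <= 1 + x.
Proof.
move=> x0.
pose f (t : R) := (1 + t) * expR (- t) - (1 - t) * expR t.
have df (t : R) : is_derive t 1 f (t * (expR t - expR (- t))).
  rewrite /f; apply: is_derive_eq; rewrite /GRing.scale /=; ring.
have : f 0 <= f x.
  have ff t : derivable f t 1 by case: (df t).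
  apply: (@ger0_derive1_ndecr _ f 0 x) => //.
  - move=> t; rewrite in_itv/= => /andP[t0 _]; rewrite derive1E.
    case: (df t) => _ ->.
    rewrite mulr_ge0 ?(ltW t0)// subr_ge0 ler_expR; lra.
  - by apply: continuous_subspaceT => t; apply/differentiable_continuous/derivable1_diffP.
rewrite /f oppr0 expR0 addr0 subrr subr_ge0 => h.
have -> : 2 * x = x + x by ring.
apply: (@le_trans _ _ ((1 + x) * expR (- x) * expR x)).
  by rewrite expRD mulrA ler_wpM2r ?expR_ge0.
by rewrite -mulrA [expR _ * _]mulrC expRxMexpNx_1 mulr1.
Qed.

Lemma expR_cayley_ge (R : realType) (x : R) : 0 <= x <= 2^-1 ->
  1 + x <= (1 - x) * expR (2 * x + 4 * x ^+ 3).
Proof.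
move=> /andP[x0 x1].
have y0 : 0 <= 2 * x + 4 * x ^+ 3 by rewrite addr_ge0 ?mulr_ge0 ?exprn_ge0.
apply: (@le_trans _ _ ((1 - x) *
    (1 + (2 * x + 4 * x ^+ 3) + (2 * x + 4 * x ^+ 3) ^+ 2 / 2))); last first.
  by rewrite ler_wpM2l ?expR_ge2//; lra.
have x3 : 0 <= x ^+ 3 by rewrite exprn_ge0.
have x4 : 0 <= x ^+ 3 * (2^-1 - x) by rewrite mulr_ge0//; lra.
have x5 : 0 <= (1 - x) * (8 * (x * x ^+ 3) + 8 * (x ^+ 3 * x ^+ 3)).
  have p1 : 0 <= x * x ^+ 3 by rewrite mulr_ge0.
  have p2 : 0 <= x ^+ 3 * x ^+ 3 by rewrite mulr_ge0.
  by apply: mulr_ge0; lra.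
rewrite -subr_ge0.
have -> : (1 - x) * (1 + (2 * x + 4 * x ^+ 3) + (2 * x + 4 * x ^+ 3) ^+ 2 / 2) -
    (1 + x) = 4 * (x ^+ 3 * (2^-1 - x)) +
     (1 - x) * (8 * (x * x ^+ 3) + 8 * (x ^+ 3 * x ^+ 3)).
  by field.
by rewrite addr_ge0// mulr_ge0.
Qed.

Section BinomialEstimates.
Variable R : realType.
Implicit Types N j k : nat.

Definition binp N j : R := 'C(N, j)%:R / 2 ^+ N.

(* The sum of N signs, j of which are -1. *)
Definition dev N j : R := N%:R - 2 * j%:R.

(** With variance N + 1, consecutive Gaussian values have ratio e^{2 o} for o = (dev - 1) / (N + 1),
    the same o for which the binomial ratio is (1 + o) / (1 - o). *)
Definition gauss_ratio N j : R := binp N j * expR (dev N j ^+ 2 / (2 * (N%:R + 1))).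

(** For odd N the deviation at [N./2] is 1; keeping its Gaussian factor makes this the maximum of
    [gauss_ratio]. *)
Definition peak N : R := gauss_ratio N N./2.

Lemma binp_ge0 N j : 0 <= binp N j.
Proof. by rewrite divr_ge0 ?exprn_ge0. Qed.

Lemma binp_gt0 N j : (j <= N)%N -> 0 < binp N j.
Proof. by move=> jN; rewrite divr_gt0 ?exprn_gt0// ltr0n bin_gt0. Qed.

Lemma gauss_ratio_ge0 N j : 0 <= gauss_ratio N j.
Proof. by rewrite mulr_ge0 ?binp_ge0 ?expR_ge0. Qed.

Lemma peak_gt0 N : 0 < peak N.
Proof.
rewrite mulr_gt0 ?expR_gt0// binp_gt0//.
by rewrite -{2}[N]odd_double_half -addnn addnA leq_addl.
Qed.

Lemma binp_step N j : (j < N)%N ->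
  binp N j.+1 * (N%:R + 1 - (dev N j - 1)) = binp N j * (N%:R + 1 + (dev N j - 1)).
Proof.
move=> jN; have /(congr1 (fun k => k%:R : R)) := mul_bin_left N j.
rewrite !natrM natrB ?(ltnW jN)// -natr1 => e.
rewrite /binp /dev; have p0 : (2 : R) ^+ N != 0 by rewrite expf_neq0.
transitivity (2 * ((j%:R + 1) * 'C(N, j.+1)%:R) / 2 ^+ N : R); first by field.
by rewrite e; field.
Qed.

Lemma dev_sub N j : (j <= N)%N -> dev N (N - j) = - dev N j.
Proof. by move=> jN; rewrite /dev natrB//; ring. Qed.

Lemma gauss_ratio_sym N j : (j <= N)%N -> gauss_ratio N (N - j) = gauss_ratio N j.
Proof. by move=> jN; rewrite /gauss_ratio /binp dev_sub// sqrrN bin_sub. Qed.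

Lemma dev_half_ge0 N j : (j <= N./2)%N -> 0 <= dev N j.
Proof.
move=> jN; rewrite /dev subr_ge0 -natrM ler_nat mul2n.
by rewrite -[leqRHS]odd_double_half (leq_trans _ (leq_addl _ _))// leq_double.
Qed.

Lemma dev_half_ge2 N j : (j < N./2)%N -> 2 <= dev N j.
Proof. by move/dev_half_ge0; rewrite /dev -natr1; lra. Qed.

Lemma gauss_ratio_step N j : (j < N./2)%N ->
  let o := (dev N j - 1) / (N%:R + 1) in
  gauss_ratio N j <= gauss_ratio N j.+1 /\
  (o <= 2^-1 -> gauss_ratio N j.+1 <= gauss_ratio N j * expR (4 * o ^+ 3)).
Proof.
move=> jN o; have m2 := dev_half_ge2 jN.
have N0 : 0 <= (N%:R : R) by [].
have N1 : 0 < N%:R + 1 :> R by lra.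
have jN' : (j < N)%N.
  by apply: (leq_trans jN); rewrite -[leqRHS]odd_double_half -addnn addnA leq_addl.
have o0 : 0 <= o by rewrite divr_ge0//; lra.
have o1 : o < 1.
  by rewrite ltr_pdivrMr// mul1r /dev; have : 0 <= (j%:R : R) by []; lra.
have bE : binp N j.+1 * (1 - o) = binp N j * (1 + o).
  have := binp_step jN'; have -> : dev N j - 1 = o * (N%:R + 1).
    by rewrite /o divfK// gt_eqF.
  move=> e; apply: (mulIf (lt0r_neq0 N1)).
  by transitivity (binp N j.+1 * (N%:R + 1 - o * (N%:R + 1))); [ring|rewrite e; ring].
have b0 := binp_ge0 N j; have b1 := binp_ge0 N j.+1.
have E : expR (dev N j ^+ 2 / (2 * (N%:R + 1))) =
    expR (2 * o) * expR (dev N j.+1 ^+ 2 / (2 * (N%:R + 1))).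
  rewrite -expRD; congr expR; rewrite /o /dev -natr1; field.
  by rewrite gt_eqF.
have e0 := expR_ge0 (dev N j.+1 ^+ 2 / (2 * (N%:R + 1))).
split.
  rewrite /gauss_ratio E mulrA ler_wpM2r//.
  have h := expR_cayley o0.
  have o1' : 0 < 1 - o by lra.
  by rewrite -(ler_pM2r o1') bE -[leLHS]mulrA ler_wpM2l// mulrC.
move=> o2; rewrite /gauss_ratio E.
have o1' : 0 < 1 - o by lra.
have h : 1 + o <= (1 - o) * expR (2 * o + 4 * o ^+ 3).
  by apply: expR_cayley_ge; rewrite o0.
move: h; rewrite expRD; move: (expR (2 * o)) (expR (4 * _)) e0 => A B.
move: (expR _) => C C0 h.
have -> : binp N j * (A * C) * B = binp N j * (A * B) * C by ring.
rewrite ler_wpM2r// -(ler_pM2r o1') bE -[leRHS]mulrA ler_wpM2l//.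
by rewrite [leRHS]mulrC.
Qed.

Lemma gauss_ratio_near_peak N k : (k <= N./2)%N ->
  gauss_ratio N (N./2 - k) <= peak N.
Proof.
elim: k => [|k IH] kN; first by rewrite subn0.
apply: le_trans (IH (ltnW kN)).
have h : (N./2 - k.+1 < N./2)%N by rewrite ltn_subrL/=; case: (N./2) kN.
by have [] := gauss_ratio_step h; rewrite -subSn// subSS.
Qed.

Lemma gauss_ratio_le_peak N j : (j <= N)%N -> gauss_ratio N j <= peak N.
Proof.
move=> jN; wlog jN2 : j jN / (j <= N./2)%N => [H|].
  have [/H|jN2] := leqP j N./2; first exact.
  rewrite -gauss_ratio_sym//; apply: H; first exact: leq_subr.
  rewrite leq_subLR; apply: (@leq_trans (N./2.+1 + N./2)); last by rewrite leq_add2r.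
  rewrite -{1}[N]odd_double_half addSn addnn -add1n leq_add2r.
  by case: (odd N).
by rewrite -(subKn jN2); apply: gauss_ratio_near_peak; exact: leq_subr.
Qed.

Lemma binp_le N j : (j <= N)%N ->
  binp N j <= peak N * expR (- (dev N j ^+ 2 / (2 * (N%:R + 1)))).
Proof.
move=> /gauss_ratio_le_peak; rewrite /gauss_ratio => h.
rewrite -ler_pdivrMr ?expR_gt0//.
by rewrite -expRN opprK.
Qed.

(** The cubic errors of the steps telescope, since m^4 - (m - 2)^4 = 8 (m - 1)^3 + 8 (m - 1). *)
Lemma peak_le_gauss_ratio N k : (k <= N./2)%N ->
  2 * dev N (N./2 - k) <= N%:R + 1 ->
  peak N <= gauss_ratio N (N./2 - k) *
    expR (dev N (N./2 - k) ^+ 4 / (2 * (N%:R + 1) ^+ 3)).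
Proof.
have N1 : 0 < N%:R + 1 :> R by have : 0 <= (N%:R : R) by []; lra.
elim: k => [|k IH] kN.
  move=> _; rewrite subn0 -[leLHS]mulr1 ler_wpM2l ?gauss_ratio_ge0//.
  rewrite -[leLHS]expR0 ler_expR divr_ge0 ?mulr_ge0 ?exprn_ge0 ?(ltW N1) ?dev_half_ge0//.
have h : (N./2 - k.+1 < N./2)%N by rewrite ltn_subrL/=; case: (N./2) kN.
have hS : (N./2 - k = (N./2 - k.+1).+1)%N by rewrite -subSn// subSS.
move: (IH (ltnW kN)); rewrite hS; move: (N./2 - k.+1)%N h => j jN {}IH jD.
have dS : dev N j.+1 = dev N j - 2 by rewrite /dev -natr1; ring.
have m2 := dev_half_ge2 jN.
have [_ step] := gauss_ratio_step jN.
apply: (le_trans (IH _)); first by rewrite dS; lra.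
have o2 : (dev N j - 1) / (N%:R + 1) <= 2^-1 by rewrite ler_pdivrMr//; lra.
apply: (@le_trans _ _ (gauss_ratio N j * expR (4 * ((dev N j - 1) / (N%:R + 1)) ^+ 3)
   * expR (dev N j.+1 ^+ 4 / (2 * (N%:R + 1) ^+ 3)))).
  by rewrite ler_wpM2r ?expR_ge0//; exact: step.
rewrite -mulrA -expRD ler_wpM2l ?gauss_ratio_ge0// ler_expR dS.
move: (dev N j) m2 => m m2; rewrite -subr_ge0.
have -> : m ^+ 4 / (2 * (N%:R + 1) ^+ 3) -
    (4 * ((m - 1) / (N%:R + 1)) ^+ 3 + (m - 2) ^+ 4 / (2 * (N%:R + 1) ^+ 3)) =
    4 * (m - 1) / (N%:R + 1) ^+ 3.
  by field; rewrite gt_eqF.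
by rewrite divr_ge0 ?exprn_ge0 ?(ltW N1)// mulr_ge0//; lra.
Qed.

Lemma binp_ge N j : (j <= N)%N -> 2 * `|dev N j| <= N%:R + 1 ->
  peak N * expR (- (dev N j ^+ 2 / (2 * (N%:R + 1)) +
    dev N j ^+ 4 / (2 * (N%:R + 1) ^+ 3))) <= binp N j.
Proof.
move=> jN dj.
suff : peak N <= gauss_ratio N j * expR (dev N j ^+ 4 / (2 * (N%:R + 1) ^+ 3)).
  rewrite /gauss_ratio -mulrA -expRD => h.
  by rewrite expRN ler_pdivrMr ?expR_gt0.
wlog jN2 : j jN dj / (j <= N./2)%N => [H|].
  have [|jN2] := leqP j N./2; first exact: H.
  have := H (N - j)%N; rewrite gauss_ratio_sym// dev_sub// normrN.
  have -> : (- dev N j) ^+ 4 = dev N j ^+ 4 by ring.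
  apply => //; first exact: leq_subr.
  rewrite leq_subLR; apply: (@leq_trans (N./2.+1 + N./2)); last by rewrite leq_add2r.
  rewrite -{1}[N]odd_double_half addSn addnn -add1n leq_add2r.
  by case: (odd N).
rewrite -(subKn jN2); apply: peak_le_gauss_ratio; first exact: leq_subr.
by rewrite subKn//; apply: le_trans dj; rewrite ler_wpM2l ?ler_norm.
Qed.

Lemma central_step k : binp k.+1.*2 k.+1 * (2 * (k%:R + 1)) = binp k.*2 k * (2 * k%:R + 1).
Proof.
have e1 : ('C(k.+1.*2, k.+1) = 2 * 'C(k.*2.+1, k))%N.
  rewrite doubleS binS mul2n -[RHS]addnn; congr (_ + _)%N.
  rewrite -[in RHS](@bin_sub k.*2.+1 k); last by rewrite -addnn -addSn leq_addl.
  by congr 'C(_, _); rewrite -addnn -addSn addnK.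
have e2 : (k.+1 * 'C(k.*2.+1, k) = k.*2.+1 * 'C(k.*2, k))%N.
  rewrite -[in LHS](@bin_sub k.*2.+1 k); last by rewrite -addnn -addSn leq_addl.
  by rewrite -[in LHS]addnn -addSn addnK addSn addnn -mul_bin_diag.
have {e2} := congr1 (fun k => k%:R : R) e2; rewrite !natrM -!natr1 => e2.
rewrite /binp e1 doubleS !exprS natrM.
transitivity (((k%:R + 1) * 'C(k.*2.+1, k)%:R) / (2 ^+ k.*2) : R); first by field.
by rewrite e2 -muln2 natrM; field.
Qed.

(** The monotone sequences behind the Wallis product: one increases and the other decreases to 1 /
    pi. They compare central coefficients with one another without Stirling's formula. *)
Lemma central_mono j k : (j <= k)%N ->
  j%:R * binp j.*2 j ^+ 2 <= k%:R * binp k.*2 k ^+ 2 /\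
  (k%:R + 2^-1) * binp k.*2 k ^+ 2 <= (j%:R + 2^-1) * binp j.*2 j ^+ 2.
Proof.
move=> /subnKC <-; elim: (k - j)%N => [|i [IH1 IH2]]; first by rewrite addn0.
rewrite addnS; set m := (j + i)%N.
have m0 : 0 <= (m%:R : R) by [].
have bE : binp m.+1.*2 m.+1 = binp m.*2 m * ((2 * m%:R + 1) / (2 * (m%:R + 1))).
  have := central_step m => e.
  apply: (@mulIf _ (2 * (m%:R + 1))); first by rewrite gt_eqF//; lra.
  by rewrite e; field; rewrite gt_eqF//; lra.
have b2 : 0 <= binp m.*2 m ^+ 2 by rewrite sqr_ge0.
have i0 : 0 <= (m%:R + 1 : R)^-1 by rewrite invr_ge0; lra.
rewrite -[m.+1%:R]natr1 bE; split.
  apply: (le_trans IH1); rewrite -/m; move: (binp m.*2 m) b2 => b b2.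
  rewrite -subr_ge0; set q := (X in b * X).
  have -> : (m%:R + 1) * (b * q) ^+ 2 - m%:R * b ^+ 2 = b ^+ 2 * ((m%:R + 1)^-1 / 4).
    by rewrite /q; field; rewrite gt_eqF//; lra.
  by rewrite mulr_ge0// divr_ge0.
apply: le_trans IH2; rewrite -/m; move: (binp m.*2 m) b2 => b b2.
rewrite -subr_ge0; set q := (X in b * X).
have -> : (m%:R + 2^-1) * b ^+ 2 - (m%:R + 1 + 2^-1) * (b * q) ^+ 2 =
    b ^+ 2 * ((2 * m%:R + 1) * ((m%:R + 1)^-1) ^+ 2 / 8).
  by rewrite /q; field; rewrite gt_eqF//; lra.
by rewrite mulr_ge0// mulr_ge0// mulr_ge0 ?sqr_ge0//; lra.
Qed.

Lemma central_compare j k :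
  j%:R * binp j.*2 j ^+ 2 <= (k%:R + 2^-1) * binp k.*2 k ^+ 2.
Proof.
have b2 m : 0 <= binp m.*2 m ^+ 2 by rewrite sqr_ge0.
have [jk|/ltnW kj] := leqP j k.
  have [h _] := central_mono jk; apply: (le_trans h).
  by rewrite ler_wpM2r//; lra.
have [_ h] := central_mono kj; apply: le_trans h.
by rewrite ler_wpM2r//; lra.
Qed.

Lemma peak_double k : peak k.*2 = binp k.*2 k.
Proof.
rewrite /peak doubleK /gauss_ratio /dev -muln2 natrM.
have -> : k%:R * 2 - 2 * k%:R = 0 :> R by ring.
by rewrite expr0n /= mul0r expR0 mulr1.
Qed.

Lemma peak_doubleS k :
  peak k.*2.+1 = binp k.+1.*2 k.+1 * expR (4 * (k%:R + 1))^-1.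
Proof.
rewrite /peak -[k.*2.+1]addn1 [(_ + 1)%N]addnC [(1 + _)./2]/= uphalf_double.
rewrite /gauss_ratio; congr (_ * expR _).
  have e1 : ('C(k.+1.*2, k.+1) = 2 * 'C(1 + k.*2, k))%N.
    rewrite doubleS binS mul2n -[RHS]addnn; congr (_ + _)%N.
    rewrite -[in RHS](@bin_sub (1 + k.*2) k); last by rewrite -addnn addnA leq_addl.
    by congr 'C(_, _); rewrite -addnn addnA addnK add1n.
  rewrite /binp e1 doubleS add1n !exprS natrM; field.
  by rewrite expf_neq0.
rewrite /dev natrD -muln2 natrM; field; rewrite ?gt_eqF//.
Qed.

(** Any witness will do, as [central_compare] holds for all pairs. An odd N = 2 k + 1 is reduced to
    the central coefficient of 2 k + 2. *)
Lemma peak_upper N : exists j, N%:R * peak N ^+ 2 <= 2 * (j%:R * binp j.*2 j ^+ 2).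
Proof.
have := odd_double_half N; case: (odd N); move: (N./2) => k <-; last first.
  exists k; rewrite add0n peak_double -{1}muln2 natrM.
  by rewrite [_ * 2]mulrC -mulrA.
exists k.+1; rewrite add1n peak_doubleS.
have -> : k.*2.+1%:R = 2 * k%:R + 1 :> R by rewrite -natr1 -muln2 natrM mulrC.
rewrite -[k.+1%:R]natr1; move: (binp _ _) => b.
have k0 : 0 <= (k%:R : R) by [].
rewrite exprMn -expRM_natl.
(* Here e^{1 / (2 (k + 1))} is replaced by (2 k + 2) / (2 k + 1), which exactly cancels the factor 2
   k + 1. *)
apply: (@le_trans _ _ ((2 * k%:R + 1) * (b ^+ 2 * (1 - (2 * (k%:R + 1))^-1)^-1))).
  apply: ler_wpM2l; first lra.
  apply: ler_wpM2l; first exact: sqr_ge0.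
  apply: le_trans (expR_le_inv1B _); last by rewrite invf_lt1; lra.
  rewrite ler_expR le_eqVlt; apply/orP; left; apply/eqP; field.
  by rewrite gt_eqF//; lra.
rewrite le_eqVlt; apply/orP; left; apply/eqP; field.
by apply/andP; split; rewrite gt_eqF//; lra.
Qed.

Lemma peak_lower N : exists k,
  2 * ((k%:R + 2^-1) * binp k.*2 k ^+ 2) <= (N%:R + 2) * peak N ^+ 2.
Proof.
have := odd_double_half N; case: (odd N); move: (N./2) => k <-; last first.
  exists k; rewrite add0n peak_double -{2}muln2 natrM.
  have := sqr_ge0 (binp k.*2 k); move: (_ ^+ 2) => b b0; have : 0 <= (k%:R : R) by [].
  lra.
exists k.+1; rewrite add1n peak_doubleS.
have -> : k.*2.+1%:R = 2 * k%:R + 1 :> R by rewrite -natr1 -muln2 natrM mulrC.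
rewrite -[k.+1%:R]natr1; move: (binp _ _) => b.
have k0 : 0 <= (k%:R : R) by [].
rewrite exprMn -expRM_natl.
have : 1 <= expR (2%:R * (4 * (k%:R + 1))^-1) :> R.
  by rewrite -[leLHS]expR0 ler_expR mulr_ge0// invr_ge0; lra.
move: (expR _) => e e1; have := sqr_ge0 b; move: (b ^+ 2) => b2 b0.
have : 0 <= (2 * k%:R + 3) * b2 * (e - 1) by apply: mulr_ge0; [apply: mulr_ge0|]; lra.
lra.
Qed.

(* N peak(N)^2 and (N + 2) peak(N)^2 lie on either side of their limit 2 / pi. *)
Lemma peak_compare N N' : N%:R * peak N ^+ 2 <= (N'%:R + 2) * peak N' ^+ 2.
Proof.
have [j upper] := peak_upper N; have [k lower] := peak_lower N'.
apply: (le_trans upper); apply: le_trans lower.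
by rewrite ler_wpM2l// central_compare.
Qed.

End BinomialEstimates.

(** * Hamming distances *)

Section Hamming.
Variable n : nat.
Local Open Scope set_scope.
Implicit Types r x y : {ffun 'I_n -> bool}.

Definition hamming r x : nat := #|[set k | r k != x k]|.

Lemma hamming_le r x : (hamming r x <= n)%N.
Proof. by rewrite -[leqRHS]card_ord max_card. Qed.

Lemma card_hamming x J : #|[set r | hamming r x == J]| = 'C(n, J).
Proof.
pose f (B : {set 'I_n}) : {ffun 'I_n -> bool} := [ffun k => x k (+) (k \in B)].
have hf B : hamming (f B) x = #|B|.
  by rewrite /hamming; apply: eq_card => k; rewrite !inE ffunE; case: (x k); case: (k \in B).
have fI : injective f.
  move=> B B' /ffunP e; apply/setP => k; have := e k; rewrite !ffunE.
  by case: (x k); case: (k \in B); case: (k \in B').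
rewrite -[n in RHS]card_ord -card_draws -(card_imset _ fI); apply: eq_card => r.
rewrite inE; apply/eqP/imsetP => [rJ|[B + ->]]; last by rewrite inE hf => /eqP.
exists [set k | r k != x k]; first by rewrite inE -rJ.
by apply/ffunP => k; rewrite ffunE inE; case: (x k); case: (r k).
Qed.

(** Among the positions where r and x differ, i1 lie where x and y agree and i2 where they do not. J
    and J' determine both numbers, so one product of binomial coefficients bounds the count, and not
    a sum. *)
Lemma card_hamming2 x y J J' : let h := hamming x y in
  #|[set r | (hamming r x == J) && (hamming r y == J')]| = 0%N \/
  exists i1 i2, [/\ (i1 <= n - h)%N, (i2 <= h)%N, (i1 + i2 = J)%N,
    (i1 + h = J' + i2)%N &
    (#|[set r | (hamming r x == J) && (hamming r y == J')]| <= 'C(n - h, i1) * 'C(h, i2))%N].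
Proof.
move=> h; pose D := [set k | x k != y k].
pose A1 r := [set k | (r k != x k) && (x k == y k)].
pose A2 r := [set k | (r k != x k) && (x k != y k)].
have hD : #|D| = h by [].
have hDC : #|~: D| = (n - h)%N by rewrite cardsCs finset.setCK card_ord hD.
have sA1 r : A1 r \subset ~: D.
  by apply/fintype.subsetP => k; rewrite !inE negbK => /andP[].
have sA2 r : A2 r \subset D.
  by apply/fintype.subsetP => k; rewrite !inE => /andP[].
have hx r : hamming r x = (#|A1 r| + #|A2 r|)%N.
  rewrite -cardsUI; have -> : A1 r :&: A2 r = finset.set0.
    by apply/setP => k; rewrite !inE; case: (x k == y k); rewrite ?andbF.
  rewrite cards0 addn0 /hamming; apply: eq_card => k; rewrite !inE.
  by case: (x k == y k); case: (r k != x k).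
have hy r : (hamming r y + #|A2 r| = #|A1 r| + h)%N.
  rewrite -hD; have -> : #|D| = (#|D :\: A2 r| + #|A2 r|)%N.
    by rewrite cardsDS// subnK// subset_leq_card.
  rewrite addnA; congr (_ + _)%N; rewrite -cardsUI.
  have -> : A1 r :&: (D :\: A2 r) = finset.set0.
    by apply/setP => k; rewrite !inE; case: (x k == y k); rewrite ?andbF.
  rewrite cards0 addn0 /hamming; apply: eq_card => k; rewrite !inE.
  by case: (x k); case: (y k); case: (r k).
have [->|[r0]] := set_0Vmem [set r | (hamming r x == J) && (hamming r y == J')].
  by left; rewrite cards0.
rewrite inE => /andP[/eqP r0x /eqP r0y]; right.
exists #|A1 r0|, #|A2 r0|; split.
- by rewrite -hDC subset_leq_card.
- by rewrite -hD subset_leq_card.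
- by rewrite -hx.
- by rewrite -hy r0y.
rewrite -hDC -hD -!cards_draws -cardsX.
have AI : injective (fun r => (A1 r, A2 r)).
  move=> r r' [/setP e1 /setP e2]; apply/ffunP => k.
  have := e1 k; have := e2 k; rewrite !inE.
  by case: (x k); case: (y k); case: (r k); case: (r' k).
rewrite -(card_imset _ AI); apply/subset_leq_card/fintype.subsetP => _ /imsetP[r + ->].
rewrite inE => /andP[/eqP rx /eqP ry]; rewrite inE /= !inE sA1 sA2 /=.
have := hx r; have := hy r; have := hx r0; have := hy r0.
rewrite rx ry r0x r0y; move: #|A1 r0| #|A2 r0| #|A1 r| #|A2 r| => p q s t a b c e.
by apply/andP; split; apply/eqP; lia.
Qed.

End Hamming.

(** * Correlation of two signed sums of a row *)

Section RowHits.
Variables (R : realType) (n : nat).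
Implicit Types (x y r : {ffun 'I_n -> bool}).

(** The probability of a slot: since <r, x> is [dev R n (hamming r x)], a slot is a pair j, j.+1 of
    Hamming distances. *)
Definition rowp j : R := binp R n j + binp R n j.+1.

Definition hit r x j := (hamming r x == j) || (hamming r x == j.+1).

Lemma card_hit x j : #|[set r | hit r x j]%SET|%:R / 2 ^+ n = rowp j.
Proof.
rewrite /rowp /binp -mulrDl -natrD -!(card_hamming x) -cardsUI.
rewrite [X in (_ + X)%N](_ : _ = 0%N); last first.
  apply/eqP; rewrite cards_eq0; apply/eqP/setP => r; rewrite !inE.
  by apply/negP => /andP[/eqP -> /eqP]; lia.
by rewrite addn0; congr (_%:R / _); apply: eq_card => r; rewrite !inE.
Qed.

Lemma rowp_gt0 j : (j <= n)%N -> 0 < rowp j.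
Proof. by move=> jn; rewrite ltr_pwDl ?binp_gt0 ?binp_ge0. Qed.

Lemma card_hamming2_odd x y J J' : odd (J + J' + hamming x y) ->
  #|[set r | (hamming r x == J) && (hamming r y == J')]%SET| = 0%N.
Proof.
have [//|[i1 [i2 [_ _ e1 e2 _]]]] := card_hamming2 x y J J'.
have -> : (J + J' + hamming x y = (i1 + hamming x y).*2)%N by rewrite -addnn; lia.
by rewrite odd_double.
Qed.

Lemma card_hit2 x y j j' :
  let N J J' := #|[set r | (hamming r x == J) && (hamming r y == J')]%SET| in
  #|[set r | hit r x j && hit r y j']%SET| =
   (N j j' + N j.+1 j'.+1 + (N j j'.+1 + N j.+1 j'))%N.
Proof.
rewrite /= -!sum1_card.
rewrite !(big_mkcond (fun r => r \in _)) /= -!big_split /=; apply: eq_bigr => r _.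
rewrite !inE /hit.
have [->|nj] := eqVneq (hamming r x) j.
  rewrite (ltn_eqF (ltnSn j)) /=.
  have [->|nj'] := eqVneq (hamming r y) j'; first by rewrite (ltn_eqF (ltnSn j')).
  by case: eqP.
have [_|nj1] := eqVneq (hamming r x) j.+1; last by [].
have [->|nj'] := eqVneq (hamming r y) j'; first by rewrite (ltn_eqF (ltnSn j')).
by case: eqP.
Qed.

End RowHits.

Section RowCorrelation.
Variables (R : realType) (n : nat).
Hypothesis n_gt0 : (0 < n)%N.
Implicit Types (x y r : {ffun 'I_n -> bool}).

(** As peak(N) is about sqrt (2 / (pi N)), the left side over peak(n)^2 is about n / sqrt (D h) = 2
    / sqrt (1 - g^2 / n^2), because 4 D h = n^2 - g^2. *)
Lemma peak_mul D h : (D + h = n)%N -> let g : R := D%:R - h%:R in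
  2 * `|g| <= n%:R ->
  peak R D * peak R h <= 2 * expR (2 / n%:R + g ^+ 2 / n%:R ^+ 2) * peak R n ^+ 2.
Proof.
move=> Dh g gn; have n0 : 0 < n%:R :> R by rewrite ltr0n.
have nE : n%:R = D%:R + h%:R :> R by rewrite -Dh natrD.
move: gn; rewrite -[2 * _]ger0_norm ?mulr_ge0// normrM normr_id -normrM ler_norml.
move=> /andP[g1 g2].
have D0 : 0 < D%:R :> R by rewrite /g in g1; lra.
have h0 : 0 < h%:R :> R by rewrite /g in g2; lra.
have pn := peak_gt0 R n; have pD := peak_gt0 R D; have ph := peak_gt0 R h.
have e0 := expR_ge0 (2 / n%:R + g ^+ 2 / n%:R ^+ 2).
rewrite -(@ler_pXn2r _ 2)// ?nnegrE ?mulr_ge0 ?sqr_ge0 ?(ltW pD) ?(ltW ph)//.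
have Dh0 : 0 < D%:R * h%:R :> R by rewrite mulr_gt0.
rewrite -(ler_pM2l Dh0).
apply: (@le_trans _ _ ((n%:R + 2) ^+ 2 * (peak R n ^+ 2) ^+ 2)).
  have -> : D%:R * h%:R * (peak R D * peak R h) ^+ 2 =
      (D%:R * peak R D ^+ 2) * (h%:R * peak R h ^+ 2) by ring.
  have -> : (n%:R + 2) ^+ 2 * (peak R n ^+ 2) ^+ 2 =
      ((n%:R + 2) * peak R n ^+ 2) * ((n%:R + 2) * peak R n ^+ 2) by ring.
  by apply: ler_pM; rewrite ?peak_compare// mulr_ge0 ?sqr_ge0// ltW.
rewrite [X in _ <= _ * X]exprMn [leRHS]mulrA ler_wpM2r ?sqr_ge0//.
rewrite exprMn -expRM_natl mulrDr expRD.
set q := g ^+ 2 / n%:R ^+ 2.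
have q0 : 0 <= q <= 2^-1.
  rewrite divr_ge0 ?sqr_ge0//= ler_pdivrMr ?exprn_gt0//; nra.
have E1 := inv1B_le_expR q0.
have E2 : (1 + 2 / n%:R) ^+ 2 <= expR (2%:R * (2 / n%:R)) :> R.
  rewrite expRM_natl; apply: lerXn2r; rewrite ?nnegrE ?expR_ge0 ?expR_ge1Dx ?addr_ge0 ?divr_ge0//.
have q1 : 0 < 1 - q by case/andP: q0 => *; lra.
have DhE : D%:R * h%:R = n%:R ^+ 2 * (1 - q) / 4 :> R.
  rewrite /q /g; rewrite nE; field; rewrite -nE; exact: lt0r_neq0.
apply: (@le_trans _ _ (D%:R * h%:R * (4 * ((1 + 2 / n%:R) ^+ 2 * (1 - q)^-1)))).
  rewrite DhE le_eqVlt; apply/orP; left; apply/eqP; field.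
  by rewrite !gt_eqF.
rewrite ler_wpM2l ?(ltW Dh0)//.
have -> : 2 ^+ 2 = 4 :> R by ring.
rewrite ler_wpM2l//; apply: ler_pM => //; rewrite ?sqr_ge0 ?invr_ge0//.
exact: ltW.
Qed.

(** The diagonal terms nearly cancel: 4 (D + 1) (h + 1) <= (n + 2)^2 leaves at most (m^2 + m'^2) /
    (2 (n + 1) (n + 2)) of them. Only the cross term survives. *)
Lemma gauss_exponent (D h m m' T : R) : 0 <= D -> 0 <= h -> D + h = n%:R ->
  `|m| <= T -> `|m'| <= T ->
  - (((m + m') / 2) ^+ 2 / (2 * (D + 1)) + ((m - m') / 2) ^+ 2 / (2 * (h + 1))) +
    (m ^+ 2 / (2 * (n%:R + 1)) + m' ^+ 2 / (2 * (n%:R + 1))) <=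
  T ^+ 2 / n%:R ^+ 2 + (D - h) / (4 * (D + 1) * (h + 1)) * (m * m').
Proof.
move=> D0 h0 Dh mT m'T; have n0 : 0 < n%:R :> R by rewrite ltr0n.
have sq (z : R) : `|z| <= T -> z ^+ 2 <= T ^+ 2.
  move=> zT; rewrite -real_normK ?num_real// lerXn2r// nnegrE//.
  exact: le_trans zT.
have m2 := sq _ mT; have m2' := sq _ m'T.
set s := m ^+ 2 + m' ^+ 2.
have s0 : 0 <= s by rewrite addr_ge0 ?sqr_ge0.
have s1 : s <= 2 * T ^+ 2 by rewrite /s; lra.
have nD : n%:R + 2 = D + 1 + (h + 1) by rewrite -Dh; ring.
have D1 : 0 < D + 1 by lra.
have h1 : 0 < h + 1 by lra.
have -> : - (((m + m') / 2) ^+ 2 / (2 * (D + 1)) + ((m - m') / 2) ^+ 2 / (2 * (h + 1))) +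
    (m ^+ 2 / (2 * (n%:R + 1)) + m' ^+ 2 / (2 * (n%:R + 1))) =
  s / 2 * (n%:R + 1)^-1 - s / 2 * ((n%:R + 2) / (4 * ((D + 1) * (h + 1)))) +
   (D - h) / (4 * (D + 1) * (h + 1)) * (m * m').
  rewrite /s nD; have -> : n%:R + 1 = D + h + 1 by rewrite -Dh.
  by field; rewrite !gt_eqF//; lra.
rewrite lerD2r.
have k1 : (n%:R + 2)^-1 <= (n%:R + 2) / (4 * ((D + 1) * (h + 1))).
  rewrite ler_pdivlMr ?mulr_gt0//.
  rewrite ler_pdivrMl; last lra.
  by rewrite nD; have := sqr_ge0 (D - h); rewrite -subr_ge0; lra.
apply: (@le_trans _ _ (s / 2 * ((n%:R + 1)^-1 - (n%:R + 2)^-1))).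
  by rewrite mulrBr lerD2l lerN2 ler_wpM2l//; lra.
have -> : (n%:R + 1)^-1 - (n%:R + 2)^-1 = ((n%:R + 1) * (n%:R + 2))^-1 :> R.
  by field; rewrite !gt_eqF//; lra.
apply: ler_pM; rewrite ?invr_ge0 ?mulr_ge0//; try lra.
rewrite lef_pV2 ?posrE ?exprn_gt0 ?mulr_gt0//; try lra.
Qed.

(* The sums of r against x and y are u + v and u - v, where u and v are the
   sums over the coordinates on which x and y agree and disagree. *)
Lemma card_hamming2_le x y J J' (T : R) : let h := hamming x y in
  let g : R := dev R n h in
  2 * `|g| <= n%:R -> (J <= n)%N -> (J' <= n)%N -> 2 * T <= n%:R + 1 ->
  `|dev R n J| <= T -> `|dev R n J'| <= T ->
  #|[set r | (hamming r x == J) && (hamming r y == J')]%SET|%:R / 2 ^+ n <=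
  2 * (binp R n J * binp R n J') *
  expR (2 / n%:R + g ^+ 2 / n%:R ^+ 2 + T ^+ 2 / n%:R ^+ 2 + T ^+ 4 / n%:R ^+ 3 +
    g / (4 * ((n%:R - h%:R) + 1) * (h%:R + 1)) * (dev R n J * dev R n J')).
Proof.
move=> h g gn Jn Jn' Tn mT m'T; have n0 : 0 < n%:R :> R by rewrite ltr0n.
have T0 : 0 <= T by apply: le_trans mT.
have [->|[i1 [i2 [i1D i2h e1 e2 cle]]]] := card_hamming2 x y J J'.
  by rewrite mul0r !mulr_ge0 ?expR_ge0 ?binp_ge0.
have hn : (h <= n)%N by exact: hamming_le.
pose D := (n - h)%N; have Dh : (D + h = n)%N by rewrite subnK.
have DR : D%:R = n%:R - h%:R :> R by rewrite natrB.
have gE : D%:R - h%:R = g by rewrite DR /g /dev; ring.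
have e1R : i1%:R + i2%:R = J%:R :> R by rewrite -e1 natrD.
have e2R : i1%:R + h%:R = J'%:R + i2%:R :> R by rewrite -!natrD e2.
have uE : dev R D i1 = (dev R n J + dev R n J') / 2.
  by rewrite /dev DR -e1R; have -> : J'%:R = i1%:R + h%:R - i2%:R :> R;
    [rewrite e2R addrK|field].
have vE : dev R h i2 = (dev R n J - dev R n J') / 2.
  by rewrite /dev -e1R; have -> : J'%:R = i1%:R + h%:R - i2%:R :> R;
    [rewrite e2R addrK|field].
have pn := peak_gt0 R n.
apply: (@le_trans _ _ (binp R D i1 * binp R h i2)).
  rewrite /binp mulrACA -invfM -exprD Dh ler_wpM2r ?invr_ge0 ?exprn_ge0//.
  by rewrite -natrM ler_nat.
apply: (@le_trans _ _ (peak R D * expR (- (dev R D i1 ^+ 2 / (2 * (D%:R + 1)))) *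
   (peak R h * expR (- (dev R h i2 ^+ 2 / (2 * (h%:R + 1))))))).
  by apply: ler_pM; rewrite ?binp_ge0 ?binp_le.
rewrite mulrACA -expRD.
have gn' : 2 * `|D%:R - h%:R| <= n%:R :> R by rewrite gE.
have pk := peak_mul Dh gn'; rewrite gE in pk.
apply: (le_trans (ler_wpM2r (expR_ge0 _) pk)).
have sq (z : R) : `|z| <= T -> z ^+ 4 <= T ^+ 4.
  move=> zT; have -> : z ^+ 4 = `|z| ^+ 4.
    by rewrite -normrX ger0_norm// exprn_even_ge0.
  by rewrite lerXn2r// nnegrE.
have dT (z : R) : `|z| <= T -> 2 * `|z| <= n%:R + 1 by lra.
have b1 := binp_ge Jn (dT _ mT); have b2 := binp_ge Jn' (dT _ m'T).
have q4 (z : R) : `|z| <= T -> z ^+ 4 / (2 * (n%:R + 1) ^+ 3) <= T ^+ 4 / n%:R ^+ 3 / 2.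
  move=> zT; have n1 : 0 < n%:R + 1 :> R by lra.
  rewrite -mulrA -invfM [n%:R ^+ 3 * 2]mulrC.
  apply: ler_pM; [exact: exprn_even_ge0| |exact: sq|].
    by rewrite invr_ge0 mulr_ge0// exprn_ge0// ltW.
  rewrite lef_pV2 ?posrE ?mulr_gt0 ?exprn_gt0// ler_pM2l//.
  by rewrite lerXn2r// ?nnegrE; lra.
apply: (@le_trans _ _ (2 * ((peak R n * expR (- (dev R n J ^+ 2 / (2 * (n%:R + 1)) +
    dev R n J ^+ 4 / (2 * (n%:R + 1) ^+ 3)))) *
    (peak R n * expR (- (dev R n J' ^+ 2 / (2 * (n%:R + 1)) +
    dev R n J' ^+ 4 / (2 * (n%:R + 1) ^+ 3))))) *
  expR (2 / n%:R + g ^+ 2 / n%:R ^+ 2 + T ^+ 2 / n%:R ^+ 2 + T ^+ 4 / n%:R ^+ 3 +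
    g / (4 * ((n%:R - h%:R) + 1) * (h%:R + 1)) * (dev R n J * dev R n J'))));
  last first.
  rewrite ler_wpM2r ?expR_ge0// ler_wpM2l//.
  by apply: ler_pM => //; rewrite mulr_ge0 ?expR_ge0 ?(ltW pn).
set E1 := expR (2 / n%:R + _); set E2 := expR _; set E3 := expR _; set E4 := expR _.
set E5 := expR _.
have -> : 2 * E1 * peak R n ^+ 2 * E2 = 2 * peak R n ^+ 2 * (E1 * E2) by ring.
have -> : 2 * (peak R n * E3 * (peak R n * E4)) * E5 =
    2 * peak R n ^+ 2 * (E3 * E4 * E5) by ring.
rewrite ler_wpM2l ?mulr_ge0 ?sqr_ge0// /E1 /E2 /E3 /E4 /E5 -!expRD ler_expR.
have := q4 _ mT; have := q4 _ m'T.
have D0 : 0 <= n%:R - h%:R :> R by rewrite -DR.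
have h0 : 0 <= h%:R :> R by [].
have := gauss_exponent D0 h0 (subrK _ _) mT m'T.
rewrite uE vE DR; have -> : n%:R - h%:R - h%:R = g by rewrite -DR gE.
move: (dev R n J) (dev R n J') => m m'.
lra.
Qed.

Lemma binp_diff j (T : R) : (j < n)%N -> `|dev R n j| <= T -> `|dev R n j.+1| <= T ->
  `|binp R n j - binp R n j.+1| <= rowp R n j * (T / n%:R).
Proof.
move=> jn; have n0 : 0 < n%:R :> R by rewrite ltr0n.
have -> : dev R n j.+1 = dev R n j - 2 by rewrite /dev -natr1; ring.
rewrite !ler_norml => /andP[m1 m2] /andP[m3 m4].
have := binp_step R jn; rewrite /rowp.
have := binp_ge0 R n j; have := binp_ge0 R n j.+1.
move: (binp R n j) (binp R n j.+1) (dev R n j) m1 m2 m3 m4 => b c m m1 m2 m3 m4 c0 b0 e.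
rewrite mulrA -!mulNr.
have e' : (b - c) * (n%:R + 1) = - (b + c) * (m - 1) by lra.
have bc : 0 <= b + c by lra.
have T0 : 0 <= T by lra.
have a1 : 0 <= (b + c) * (T - (m - 1)) by rewrite mulr_ge0//; lra.
have a2 : 0 <= (b + c) * (T + (m - 1)) by rewrite mulr_ge0//; lra.
have a3 : 0 <= (b + c) * T by rewrite mulr_ge0.
rewrite ler_pdivlMr// ler_pdivrMr//.
by apply/andP; split; nra.
Qed.

(** Replaces slot values by targets, which are linear in x and so sum over the rows to d <Mx, My>.
    As |m m' - a a'| <= 4 T, the error is at most 8 |g| T / n^2, and 8 |g| T <= g^2 + 16 T^2. *)
Lemma cross_term (g a a' m m' T : R) : 2 * `|g| <= n%:R ->
  `|m - a| <= 2 -> `|m' - a'| <= 2 -> `|m| <= T -> `|a'| <= T ->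
  g / ((n%:R + 2) ^+ 2 - g ^+ 2) * (m * m') <=
  g / ((n%:R + 2) ^+ 2 - g ^+ 2) * (a * a') + g ^+ 2 / n%:R ^+ 2 +
  16 * (T ^+ 2 / n%:R ^+ 2).
Proof.
move=> gn ma m'a' mT aT; set k := _ - g ^+ 2.
have n0 : 0 < n%:R :> R by rewrite ltr0n.
have g2 : 4 * g ^+ 2 <= n%:R ^+ 2.
  have -> : 4 * g ^+ 2 = (2 * `|g|) ^+ 2 by rewrite exprMn real_normK ?num_real//; ring.
  by rewrite lerXn2r// nnegrE// mulr_ge0.
have n20 : 0 < n%:R ^+ 2 :> R by rewrite exprn_gt0.
have kn : n%:R ^+ 2 / 2 <= k by rewrite /k; lra.
have k0 : 0 < k by apply: lt_le_trans kn; rewrite divr_gt0.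
have dm : `|m * m' - a * a'| <= 4 * T.
  have -> : m * m' - a * a' = m * (m' - a') + a' * (m - a) by ring.
  apply: (le_trans (ler_normD _ _)); rewrite !normrM.
  have := ler_pM (normr_ge0 m) (normr_ge0 _) mT m'a'.
  have := ler_pM (normr_ge0 a') (normr_ge0 _) aT ma.
  lra.
have -> : g / k * (m * m') = g / k * (a * a') + g / k * (m * m' - a * a') by ring.
rewrite -addrA lerD2l; apply: (le_trans (ler_norm _)).
rewrite normrM [`|g / k|]normrM normfV (ger0_norm (ltW k0)).
have ki : k^-1 <= 2 / n%:R ^+ 2.
  by rewrite -[leRHS]invrK lef_pV2 ?posrE ?invr_gt0 ?divr_gt0// invf_div.
apply: (@le_trans _ _ (`|g| * (2 / n%:R ^+ 2) * (4 * T))).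
  apply: ler_pM => //; first by rewrite mulr_ge0 ?invr_ge0 ?(ltW k0).
  by rewrite ler_wpM2l.
have -> : `|g| * (2 / n%:R ^+ 2) * (4 * T) = (8 * `|g| * T) / n%:R ^+ 2.
  by field; rewrite gt_eqF.
rewrite mulrA -mulrDl ler_wpM2r ?invr_ge0 ?(ltW n20)// -(@real_normK _ g) ?num_real//.
by have := sqr_ge0 (`|g| - 4 * T); lra.
Qed.

(* By parity, only two of the four pairs of values in the two slots occur, each
   about twice as often as if independent: this is why slots have two values. *)
Lemma hit_correlation x y j j' (a a' T : R) : let h := hamming x y in
  let g : R := dev R n h in
  2 * `|g| <= n%:R -> (j < n)%N -> (j' < n)%N -> 2 * T <= n%:R + 1 ->
  `|dev R n j| <= T -> `|dev R n j.+1| <= T ->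
  `|dev R n j'| <= T -> `|dev R n j'.+1| <= T ->
  `|dev R n j - a| <= 2 -> `|dev R n j.+1 - a| <= 2 ->
  `|dev R n j' - a'| <= 2 -> `|dev R n j'.+1 - a'| <= 2 -> `|a'| <= T ->
  #|[set r | hit r x j && hit r y j']%SET|%:R / 2 ^+ n <=
  rowp R n j * rowp R n j' *
  expR (g / (4 * ((n%:R - h%:R) + 1) * (h%:R + 1)) * (a * a') +
   (2 / n%:R + 2 * (g ^+ 2 / n%:R ^+ 2) + 18 * (T ^+ 2 / n%:R ^+ 2) + T ^+ 4 / n%:R ^+ 3)).
Proof.
move=> h g gn jn jn' Tn d0 d1 d0' d1' a0 a1 a0' a1' aT.
have n0 : 0 < n%:R :> R by rewrite ltr0n.
have T0 : 0 <= T by apply: le_trans d0.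
pose N J J' := #|[set r | (hamming r x == J) && (hamming r y == J')]%SET|.
(* 17 = 1 + 16 collects the errors of [card_hamming2_le] and [cross_term]; the 18th T^2 / n^2 is
   spent on parity. *)
pose F : R := expR (g / (4 * ((n%:R - h%:R) + 1) * (h%:R + 1)) * (a * a') +
   (2 / n%:R + 2 * (g ^+ 2 / n%:R ^+ 2) + 17 * (T ^+ 2 / n%:R ^+ 2) + T ^+ 4 / n%:R ^+ 3)).
have hn : (h <= n)%N by exact: hamming_le.
have kg (m m' : R) : `|m - a| <= 2 -> `|m' - a'| <= 2 -> `|m| <= T ->
    g / (4 * ((n%:R - h%:R) + 1) * (h%:R + 1)) * (m * m') <=
    g / (4 * ((n%:R - h%:R) + 1) * (h%:R + 1)) * (a * a') + g ^+ 2 / n%:R ^+ 2 +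
    16 * (T ^+ 2 / n%:R ^+ 2).
  have -> : 4 * ((n%:R - h%:R) + 1) * (h%:R + 1) = (n%:R + 2) ^+ 2 - g ^+ 2.
    by rewrite /g /dev; ring.
  by move=> *; exact: cross_term.
have NF J J' : (J <= n)%N -> (J' <= n)%N -> `|dev R n J| <= T -> `|dev R n J'| <= T ->
    `|dev R n J - a| <= 2 -> `|dev R n J' - a'| <= 2 ->
    (N J J')%:R / 2 ^+ n <= 2 * (binp R n J * binp R n J') * F.
  move=> Jn Jn' dJ dJ' aJ aJ'; apply: (le_trans (card_hamming2_le gn Jn Jn' Tn dJ dJ')).
  rewrite ler_wpM2l ?mulr_ge0 ?binp_ge0// ler_expR.
  by have := kg _ _ aJ aJ' dJ; rewrite -/h -/g; lra.
have N0 J J' : odd (J + J' + h) -> N J J' = 0%N.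
  exact: card_hamming2_odd.
have split4 : #|[set r | hit r x j && hit r y j']%SET| =
   (N j j' + N j.+1 j'.+1 + (N j j'.+1 + N j.+1 j'))%N := card_hit2 x y j j'.
have F0 : 0 <= F by exact: expR_ge0.
have b0 J : 0 <= binp R n J by exact: binp_ge0.
have df := binp_diff jn d0 d1; have df' := binp_diff jn' d0' d1'.
have p0 := ltW (rowp_gt0 R (ltnW jn)); have p0' := ltW (rowp_gt0 R (ltnW jn')).
have dd : `|(binp R n j - binp R n j.+1) * (binp R n j' - binp R n j'.+1)| <=
    rowp R n j * rowp R n j' * (T ^+ 2 / n%:R ^+ 2).
  rewrite normrM; have -> : rowp R n j * rowp R n j' * (T ^+ 2 / n%:R ^+ 2) =
    rowp R n j * (T / n%:R) * (rowp R n j' * (T / n%:R)) by field; rewrite gt_eqF.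
  exact: ler_pM.
have dd1 := ler_norm ((binp R n j - binp R n j.+1) * (binp R n j' - binp R n j'.+1)).
have dd2 := ler_norm (- ((binp R n j - binp R n j.+1) * (binp R n j' - binp R n j'.+1))).
rewrite normrN in dd2.
apply: (@le_trans _ _ (rowp R n j * rowp R n j' * (1 + T ^+ 2 / n%:R ^+ 2) * F)); last first.
  rewrite -mulrA ler_wpM2l ?mulr_ge0//.
  apply: (le_trans (ler_wpM2r F0 (expR_ge1Dx _))); rewrite -expRD ler_expR; lra.
(* If the two slots have probabilities b, c and b', c', the pairs of one parity contribute 2 (b b' +
   c c') = (b + c) (b' + c') + (b - c) (b' - c'), and those of the other parity the same with a
   minus sign. [binp_diff] makes the last product negligible. *)
have [od|ev] := boolP (odd (j + j' + h)).
  have o1 : odd (j.+1 + j'.+1 + h) by rewrite addSn addnS /= negbK.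
  rewrite split4 (N0 _ _ od) (N0 _ _ o1) !add0n.
  rewrite natrD mulrDl.
  apply: (le_trans (lerD (NF j j'.+1 (ltnW jn) jn' d0 d1' a0 a1')
    (NF j.+1 j' jn (ltnW jn') d1 d0' a1 a0'))).
  by rewrite -mulrDl ler_wpM2r//; move: (T ^+ 2 / _) dd => t; rewrite /rowp; lra.
have o1 : odd (j + j'.+1 + h) by rewrite addnS.
have o2 : odd (j.+1 + j' + h) by rewrite addSn.
rewrite split4 (N0 _ _ o1) (N0 _ _ o2) !addn0.
rewrite natrD mulrDl.
apply: (le_trans (lerD (NF j j' (ltnW jn) (ltnW jn') d0 d0' a0 a0')
  (NF j.+1 j'.+1 jn jn' d1 d1' a1 a1'))).
by rewrite -mulrDl ler_wpM2r//; move: (T ^+ 2 / _) dd => t; rewrite /rowp; lra.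
Qed.

End RowCorrelation.

(** * The weighted count *)

(** Cauchy-Schwarz on the support of [S], obtained as the nonnegativity of a variance. *)
Lemma paley_zygmund (R : realType) (O : finType) (S : O -> R) :
  (forall w, 0 <= S w) ->
  (\sum_w S w) ^+ 2 <= #|[set w | 0 < S w]%SET|%:R * \sum_w S w ^+ 2.
Proof.
move=> S0; set A := [set w | 0 < S w]%SET; set e1 := \sum_w S w.
set e2 := \sum_w S w ^+ 2.
have SA w : w \notin A -> S w = 0.
  by rewrite inE lt_def S0 andbT negbK => /eqP.
have e1A : e1 = \sum_(w in A) S w.
  by rewrite /e1 (bigID (mem A)) /= [X in _ + X]big1 ?addr0// => w /SA.
have e2A : e2 = \sum_(w in A) S w ^+ 2.
  rewrite /e2 (bigID (mem A)) /= [X in _ + X]big1 ?addr0// => w /SA ->.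
  by rewrite expr0n.
have [A0|A0] := posnP #|A|.
  rewrite e1A big_pred0 ?expr0n ?A0 ?mul0r//.
  by move=> w; move/eqP: A0; rewrite cards_eq0 => /eqP ->; rewrite inE.
set c : R := #|A|%:R; have c0 : 0 < c by rewrite ltr0n.
have : 0 <= \sum_(w in A) (c * S w - e1) ^+ 2.
  by apply: sumr_ge0 => w _; rewrite sqr_ge0.
have -> : \sum_(w in A) (c * S w - e1) ^+ 2 = c * (c * e2 - e1 ^+ 2).
  transitivity (\sum_(w in A) (c ^+ 2 * S w ^+ 2 - 2 * c * e1 * S w + e1 ^+ 2)).
    by apply: eq_bigr => w _; ring.
  rewrite big_split /= sumrB -!big_distrr /= -e1A -e2A sumr_const -mulr_natl -/c.
  by ring.
by rewrite pmulr_rge0// subr_ge0.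
Qed.

Section SecondMoment.
Variables (R : realType) (d n : nat).
Notation signvec := {ffun 'I_n -> bool}.
Notation signmat := {ffun 'I_d -> signvec}.
Variables (mu : signvec -> R) (good : pred signvec) (j : signvec -> 'I_d -> nat).
Hypothesis mu_ge0 : forall x, 0 <= mu x.
Hypothesis j_lt : forall x i, good x -> (j x i < n)%N.
Implicit Types (x y r : signvec) (w : signmat).

Definition weighted_count w : R := \sum_(x | good x)
  mu x * \prod_i ((hit (w i) x (j x i))%:R / rowp R n (j x i)).

Definition correlation x y i : R :=
  #|[set r | hit r x (j x i) && hit r y (j y i)]%SET|%:R / 2 ^+ n /
  (rowp R n (j x i) * rowp R n (j y i)).

Lemma weighted_count_ge0 w : 0 <= weighted_count w.
Proof.
apply: sumr_ge0 => x gx; rewrite mulr_ge0// prodr_ge0// => i _.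
by rewrite divr_ge0// ltW// rowp_gt0// ltnW// j_lt.
Qed.

Lemma sumr_bool (b : pred signvec) : \sum_r (b r)%:R = #|[set r | b r]%SET|%:R :> R.
Proof.
rewrite -natr_sum -sum1_card [in RHS]big_mkcond /=; congr (_%:R).
by apply: eq_bigr => r _; rewrite inE; case: (b r).
Qed.

(** By independence of the rows the sum over [w] factors, and each normalized indicator has mean
    1. *)
Lemma weighted_count_mean :
  \sum_w weighted_count w = (2 ^+ n) ^+ d * \sum_(x | good x) mu x.
Proof.
rewrite /weighted_count exchange_big /= big_distrr /=; apply: eq_bigr => x gx.
rewrite -big_distrr /= mulrC; congr (_ * _).
rewrite -(bigA_distr_bigA (fun i r => (hit r x (j x i))%:R / rowp R n (j x i))) /=.
rewrite -[d in RHS]card_ord -prodr_const; apply: eq_bigr => i _.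
rewrite -big_distrl /= sumr_bool.
have p0 : rowp R n (j x i) != 0 by rewrite gt_eqF// rowp_gt0// ltnW// j_lt.
apply: (mulIf p0); rewrite divfK// -(card_hit R x) mulrC divfK//.
Qed.

Lemma weighted_count_sqr : \sum_w weighted_count w ^+ 2 = (2 ^+ n) ^+ d *
  \sum_(x | good x) \sum_(y | good y) mu x * mu y * \prod_i correlation x y i.
Proof.
transitivity (\sum_(w : signmat) \sum_(x | good x) \sum_(y | good y) mu x * mu y *
   \prod_i (((hit (w i) x (j x i))%:R / rowp R n (j x i)) *
            ((hit (w i) y (j y i))%:R / rowp R n (j y i)))).
  apply: eq_bigr => w _; rewrite expr2 {1}/weighted_count big_distrl /=.
  apply: eq_bigr => x _; rewrite big_distrr /=; apply: eq_bigr => y _.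
  by rewrite [in RHS]big_split /= mulrACA.
rewrite exchange_big /= big_distrr /=; apply: eq_bigr => x gx.
rewrite exchange_big /= big_distrr /=; apply: eq_bigr => y gy.
rewrite -big_distrr /= mulrCA; congr (_ * _).
rewrite -(bigA_distr_bigA (fun i r => (hit r x (j x i))%:R / rowp R n (j x i) *
  ((hit r y (j y i))%:R / rowp R n (j y i)))) /=.
have -> : (2 ^+ n) ^+ d = \prod_(i < d) 2 ^+ n :> R by rewrite prodr_const card_ord.
rewrite -big_split /=; apply: eq_bigr => i _.
have p0 : rowp R n (j x i) != 0 by rewrite gt_eqF// rowp_gt0// ltnW// j_lt.
have p1 : rowp R n (j y i) != 0 by rewrite gt_eqF// rowp_gt0// ltnW// j_lt.
rewrite /correlation -sumr_bool.
have -> : 2 ^+ n * ((\sum_r (hit r x (j x i) && hit r y (j y i))%:R) / 2 ^+ n /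
    (rowp R n (j x i) * rowp R n (j y i))) =
  (\sum_r (hit r x (j x i) && hit r y (j y i))%:R) /
    (rowp R n (j x i) * rowp R n (j y i)).
  by field; rewrite p0 p1 expf_neq0.
rewrite big_distrl /=; apply: eq_bigr => r _.
by rewrite mulrACA -natrM mulnb invfM.
Qed.

Lemma correlation_le x y i : good x -> good y ->
  0 <= correlation x y i <= (rowp R n (j y i))^-1.
Proof.
move=> gx gy.
have p0 : 0 < rowp R n (j x i) by rewrite rowp_gt0// ltnW// j_lt.
have p1 : 0 < rowp R n (j y i) by rewrite rowp_gt0// ltnW// j_lt.
apply/andP; split.
  by rewrite !divr_ge0 ?mulr_ge0 ?exprn_ge0 ?(ltW p0) ?(ltW p1).
rewrite /correlation invfM mulrA ler_piMl ?invr_ge0 ?(ltW p1)//.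
rewrite ler_pdivrMr// mul1r -(card_hit _ x) ler_wpM2r ?invr_ge0 ?exprn_ge0//.
rewrite ler_nat subset_leq_card//; apply/fintype.subsetP => r.
by rewrite !inE => /andP[].
Qed.

Lemma weighted_count_gt0 w : 0 < weighted_count w ->
  exists2 x, good x & forall i, hit (w i) x (j x i).
Proof.
move=> S0.
have [[x gx hx]|nx] := pselect (exists2 x, good x & forall i, hit (w i) x (j x i)).
  by exists x.
move: S0; rewrite /weighted_count big1 ?ltxx// => x gx.
have [i hi] : exists i, ~~ hit (w i) x (j x i).
  apply/existsP; rewrite -negb_forall; apply/negP => /forallP h; apply: nx.
  by exists x.
by rewrite (bigD1 i)//= (negPf hi) !mul0r mulr0.
Qed.

End SecondMoment.

Lemma sign_dot_dev (R : realType) (n : nat) (x y : {ffun 'I_n -> bool}) :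
  sign_dot R x y = dev R n (hamming x y).
Proof.
rewrite /sign_dot /dev /hamming -sum1_card natr_sum [in RHS]big_mkcond /= big_distrr /=.
have -> : n%:R = \sum_(k < n) 1 :> R by rewrite sumr_const card_ord.
rewrite -sumrB.
apply: eq_bigr => k _; rewrite inE.
by case: (x k); case: (y k); rewrite /= ?expr0 ?expr1; ring.
Qed.

(** * The second moment *)

Lemma total_bound (R : realType) (g s1 s2 : R) : 0 < g -> 1000 * (1000 * g) <= 1 ->
  s1 <= expR (3 * g) * (1 + 8 * (1000 * g)) -> s2 <= 1000 * g -> s1 + s2 <= 1 + 10 * (1000 * g).
Proof.
move=> g0 g1 h1 h2.
have E3 : expR (3 * g) <= 1 + 4 * g.
  apply: le_trans (expR_le_inv1B _) _; first lra.
  by rewrite -[leLHS]mul1r ler_pdivrMr; nra.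
have : expR (3 * g) * (1 + 8 * (1000 * g)) <= (1 + 4 * g) * (1 + 8 * (1000 * g)).
  by apply: ler_wpM2r; [lra|exact: E3].
have : (1000 * (1000 * g)) * g <= g by rewrite ler_piMl ?(ltW g0).
lra.
Qed.

Lemma small_exponent (R : realType) (g q : R) : 1000 * (1000 * g) <= 1 ->
  0 <= q -> q <= g -> q * (2 + 1800 * g + (100 * g) ^+ 2) <= 3 * g.
Proof.
move=> g1 q0 qg; have g0 := le_trans q0 qg.
have g100 : (100 * g) ^+ 2 <= 100 * g.
  by rewrite expr2 ler_piMr ?mulr_ge0//; lra.
apply: (@le_trans _ _ (q * 3)); last lra.
by apply: ler_wpM2l => //; lra.
Qed.

Lemma peak1_ge (R : realType) : 2^-1 <= peak R 1.
Proof.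
rewrite /peak /gauss_ratio /binp /= bin0 expr1 mul1r -[leLHS]mulr1 ler_wpM2l//.
by rewrite -[leLHS]expR0 ler_expR divr_ge0 ?sqr_ge0.
Qed.

(** * Explicit bounds for fixed d and n, with gamma = d ln d / n *)

Section FiniteTheorem.
Variables (R : realType) (d n : nat) (M : 'M[R]_(d, n)) (gamma : R).
Notation signvec := {ffun 'I_n -> bool}.
Notation D := (d%:R : R).
Notation N := (n%:R : R).
Notation L := (ln d%:R : R).
Hypothesis n_gt0 : (0 < n)%N.
Hypothesis L_ge1 : 1 <= L.
Hypothesis DLE : D * L = gamma * N.
Hypothesis gamma_small : 1000 * (1000 * gamma) <= 1.
Implicit Types x y : signvec.

Let N_gt0 : 0 < N. Proof. by rewrite ltr0n. Qed.

Let d_gt0 : (0 < d)%N.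
Proof.
by case: (d) L_ge1 => // d0; move: d0; rewrite ln0// => h; move: h; rewrite lt_geF.
Qed.

Let D_ge2 : 2 <= D.
Proof.
have D0 : 0 < D by rewrite ltr0n.
rewrite -[D]lnK ?posrE//; apply: le_trans (expR_ge1Dx _); have := L_ge1; lra.
Qed.

Let DL_gt0 : 0 < D * L. Proof. by rewrite mulr_gt0//; have := L_ge1; have := D_ge2; lra. Qed.
Let gamma_gt0 : 0 < gamma. Proof. by rewrite -(pmulr_lgt0 _ N_gt0) -DLE. Qed.
Let D_le : D <= gamma * N. Proof. by rewrite -DLE; have := L_ge1; have := D_ge2; nra. Qed.

Let W : R := Num.sqrt (D * L).
(** Targets are at most 8 W, and slot values differ from them by at most 2 <= 2 W. *)
Let T : R := 10 * W.
Let W2 : W ^+ 2 = gamma * N. Proof. by rewrite sqr_sqrtr ?(ltW DL_gt0)// DLE. Qed.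
Let W_ge1 : 1 <= W.
Proof. by rewrite -sqrtr1 ler_sqrt//; have := L_ge1; have := D_ge2; nra. Qed.
Let T_le : 2 * T <= N + 1.
Proof.
have N1 : 1 <= N by rewrite ler1n.
rewrite -(@ler_pXn2r _ 2)// ?nnegrE; first last.
- by lra.
- by have := W_ge1; rewrite /T; lra.
have -> : (2 * T) ^+ 2 = 400 * gamma * N by rewrite /T !exprMn W2; ring.
have : 0 <= (1 - 1000 * (1000 * gamma)) * N.
  by apply: mulr_ge0; [rewrite subr_ge0; exact: gamma_small|exact: ltW].
have := sqr_ge0 N; lra.
Qed.

Definition target x (i : 'I_d) : R := - (Num.sqrt D * sign_image M x i).
(** At 8 sqrt L the subgaussian tail is 2 e^{- 64 L / 32} = 2 / d^2, so that a union bound over the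
    d rows loses only 2 / d. *)
Definition tame x := [forall i, `|sign_image M x i| <= 8 * Num.sqrt L].
(** Solves n - 2 j = target and rounds down, so that the target lies between the values of [dev] at
    j.+1 and j. For tame x the argument of [truncn] is nonnegative. *)
Definition slot x (i : 'I_d) : nat := Num.truncn ((N - target x i) / 2).

Lemma target_le x i : tame x -> `|target x i| <= 8 * W.
Proof.
move=> /forallP/(_ i) h.
rewrite normrN normrM ger0_norm ?sqrtr_ge0// /W sqrtrM ?ler0n// mulrCA.
by rewrite ler_wpM2l ?sqrtr_ge0.
Qed.

Lemma slotP x i : tame x ->
  [/\ (slot x i < n)%N, `|dev R n (slot x i) - target x i| <= 2,
      `|dev R n (slot x i).+1 - target x i| <= 2,
      `|dev R n (slot x i)| <= T & `|dev R n (slot x i).+1| <= T].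
Proof.
move=> /(target_le i); rewrite ler_norml => /andP[a1 a2].
have N1 : 1 <= N by rewrite ler1n.
have T1 := T_le; have W1 := W_ge1.
have T10 : T = 10 * W by [].
have /truncn_itv/andP[j1 j2] : 0 <= (N - target x i) / 2.
  by rewrite divr_ge0//; lra.
rewrite -/(slot x i) in j1 j2.
rewrite /dev -[(slot x i).+1%:R]natr1 !ler_norml; rewrite -[(slot x i).+1%:R]natr1 in j2.
have jn : (slot x i)%:R < N by lra.
by split; [rewrite -(ltr_nat R)|..]; [|apply/andP; split; lra..].
Qed.

Lemma slot_lt x i : tame x -> (slot x i < n)%N.
Proof. by move=> tx; case: (slotP i tx). Qed.

(** The slot has probability at least peak(n) / 2, and [peak_compare] with N = 1 gives peak(n)^2 >=
    1 / (4 (n + 2)) >= 1 / (12 n); hence 48. The exponential form suits the product over rows. *)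
Lemma rowp_inv_le x i : tame x ->
  (rowp R n (slot x i))^-1 <= expR (ln (48 * N) / 2).
Proof.
move=> tx; have [jn _ _ dT _] := slotP i tx.
have N1 : 1 <= N by rewrite ler1n.
have G0 := gamma_gt0; have GS := gamma_small.
have T0 : 0 <= T by apply: le_trans dT.
have m2 : dev R n (slot x i) ^+ 2 <= 100 * gamma * N.
  have -> : 100 * gamma * N = T ^+ 2 by rewrite /T exprMn W2; ring.
  by rewrite -real_normK ?num_real// lerXn2r// nnegrE.
have b := binp_ge (ltnW jn) (le_trans (ler_wpM2l _ dT) T_le).
have {}b : peak R n / 2 <= rowp R n (slot x i).
  apply: (@le_trans _ _ (binp R n (slot x i))); last by rewrite lerDl binp_ge0.
  apply: le_trans (b _) => //; rewrite ler_wpM2l ?(ltW (peak_gt0 _ _))//.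
  apply: le_trans (expR_ge1Dx _).
  set m := dev R n (slot x i) in m2 *.
  have m4 : m ^+ 4 <= (100 * gamma * N) ^+ 2.
    have -> : m ^+ 4 = (m ^+ 2) ^+ 2 by ring.
    by rewrite lerXn2r ?nnegrE ?sqr_ge0// mulr_ge0 ?(ltW N_gt0)// mulr_ge0 ?(ltW gamma_gt0).
  have u1 : m ^+ 2 / (2 * (N + 1)) <= 50 * gamma.
    rewrite ler_pdivrMr; last lra.
    by have : 0 < gamma := gamma_gt0; lra.
  have u2 : m ^+ 4 / (2 * (N + 1) ^+ 3) <= (100 * gamma) ^+ 2 / 2.
    rewrite ler_pdivrMr; last by rewrite mulr_gt0// exprn_gt0//; lra.
    apply: (le_trans m4).
    have -> : (100 * gamma) ^+ 2 / 2 * (2 * (N + 1) ^+ 3) =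
      (100 * gamma) ^+ 2 * (N + 1) ^+ 3 by field.
    rewrite exprMn ler_wpM2l ?sqr_ge0//.
    have -> : (N + 1) ^+ 3 = N ^+ 3 + 3 * N ^+ 2 + 3 * N + 1 by ring.
    have : 0 <= N ^+ 3 by rewrite exprn_ge0 ?ltW.
    by have := sqr_ge0 N; lra.
  have : (100 * gamma) ^+ 2 <= 100 * gamma.
    by rewrite expr2 ler_piMr ?mulr_ge0 ?(ltW G0)//; lra.
  lra.
have p1 := peak1_ge R.
have pc := peak_compare R 1 n.
have p0 := peak_gt0 R n.
have r0 := rowp_gt0 R (ltnW jn).
rewrite -[expR _]invrK lef_pV2 ?posrE ?invr_gt0 ?expR_gt0// -expRN.
rewrite -(@ler_pXn2r _ 2)// ?nnegrE ?expR_ge0 ?(ltW r0)//.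
rewrite -expRM_natl; have -> : 2%:R * - (ln (48 * N) / 2) = - ln (48 * N) :> R by field.
rewrite expRN lnK ?posrE ?mulr_gt0//.
have : (peak R n / 2) ^+ 2 <= rowp R n (slot x i) ^+ 2.
  by rewrite lerXn2r// ?nnegrE ?divr_ge0// ltW.
apply: le_trans.
have : (2^-1) ^+ 2 <= peak R 1 ^+ 2 by rewrite lerXn2r// ?nnegrE// (le_trans _ p1).
have -> : (peak R n / 2) ^+ 2 = peak R n ^+ 2 / 4 by field.
rewrite mul1r in pc; move: (peak R n ^+ 2) (peak R 1 ^+ 2) pc (sqr_ge0 (peak R n)) => p q pc p_ge0 q1.
rewrite -[leLHS]mul1r ler_pdivrMr ?mulr_gt0//.
have : 0 <= p * (N - 1) by rewrite mulr_ge0//; lra.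
lra.
Qed.

(** N / 256 is half the exponent N / 128 in the tail of <x, y> beyond N / 2, so that this tail beats
    the trivial bound. *)
Lemma ln_bound : D * ln (48 * N) / 2 <= N / 256.
Proof.
have e1 : (2 : R) <= expR 1 by have := expR_ge1Dx (1 : R); lra.
have ln2n k : ln (2 ^+ k) <= k%:R :> R.
  rewrite -[leRHS]expRK ler_ln ?posrE ?exprn_gt0 ?expR_gt0//.
  by rewrite -[k%:R]mulr1 expRM_natl lerXn2r// nnegrE// expR_ge0.
have D0 : 0 < D by rewrite ltr0n.
(* With u = N / (1000 D), the inequality ln u < u costs D u = N / 1000 only; the scale 1000 is kept
   abstract as [c]. *)
have [c c0 cE] : exists2 c : R, 0 < c & c = 1000 by exists 1000; [lra|].
have -> : 48 * N = 48 * c * D * (N / (c * D)) by field; rewrite !gt_eqF.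
have u0 : 0 < N / (c * D) by rewrite divr_gt0 ?mulr_gt0.
have c48 : 0 < 48 * c by rewrite mulr_gt0.
have -> : ln (48 * c * D * (N / (c * D))) = ln (48 * c) + L + ln (N / (c * D)).
  have p1 : 48 * c * D \is Num.pos by rewrite posrE mulr_gt0.
  have p2 : N / (c * D) \is Num.pos by rewrite posrE.
  have p3 : 48 * c \is Num.pos by rewrite posrE.
  have p4 : D \is Num.pos by rewrite posrE.
  by rewrite (lnM p1 p2) (lnM p3 p4).
have : ln (48 * c) <= 16%:R.
  apply: le_trans (ln2n 16%N); rewrite ler_ln ?posrE ?mulr_gt0 ?exprn_gt0//.
  rewrite -[16%N]/(6 + 10)%N exprD; apply: ler_pM; rewrite ?(ltW c0)//.
    by rewrite -natrX ler_nat.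
  by rewrite cE -natrX ler_nat.
have := ln_sublinear u0; have := D_le; have := DLE; have := gamma_small.
move: (ln (48 * c)) (ln (N / _)) => l1 l2 gs dl dn h2 h1.
have h2' : D * l2 <= N / 1000.
  have -> : N / 1000 = D * (N / (c * D)) by rewrite -cE; field; rewrite !gt_eqF.
  by rewrite ler_wpM2l ?(ltW D0) ?(ltW h2).
have h1' : D * l1 <= 16%:R * (gamma * N).
  apply: (@le_trans _ _ (D * 16%:R)); first by rewrite ler_wpM2l ?(ltW D0).
  by rewrite mulrC ler_wpM2l ?ler0n.
have : 0 <= (1 - 1000 * (1000 * gamma)) * N.
  by apply: mulr_ge0; [rewrite subr_ge0; exact: gamma_small|exact: ltW].
lra.
Qed.

Definition sign_image_dot x y : R := \sum_i sign_image M x i * sign_image M y i.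

(** The arithmetic-geometric mean inequality is used twice: on g <Mx, My> in the exponent, then as
    e^{u + v} <= (e^{2 u} + e^{2 v}) / 2, so that each square is averaged alone. The coefficient of
    g^2 is 2 (1 + 2), with 1 from the cross term and 2 from [e0]. *)
Lemma prod_correlation_le x y : tame x -> tame y -> 2 * `|sign_dot R x y| <= N ->
  \prod_i correlation R slot x y i <=
  expR (3 * gamma) * ((expR (6 * D / N ^+ 2 * sign_dot R x y ^+ 2) +
    expR (2 * D / N ^+ 2 * sign_image_dot x y ^+ 2)) / 2).
Proof.
move=> tx ty; rewrite sign_dot_dev; set g := dev R n (hamming x y) => gn.
set k := 4 * ((N - (hamming x y)%:R) + 1) * ((hamming x y)%:R + 1).
set e0 := 2 / N + 2 * (g ^+ 2 / N ^+ 2) + 18 * (T ^+ 2 / N ^+ 2) + T ^+ 4 / N ^+ 3.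
have N1 : 1 <= N by rewrite ler1n.
have G0 := gamma_gt0; have GS := gamma_small.
have D0 : 0 < D by rewrite ltr0n.
apply: (@le_trans _ _ (expR (\sum_i (g / k * (target x i * target y i) + e0)))).
  rewrite expR_sum; apply: ler_prod => i _.
  have /andP[-> _] /= := correlation_le R slot_lt i tx ty.
  have [jx ax ax' dx dx'] := slotP i tx.
  have [jy ay ay' dy dy'] := slotP i ty.
  rewrite /correlation ler_pdivrMr ?mulr_gt0 ?rowp_gt0// 1?ltnW// [leRHS]mulrC.
  apply: hit_correlation => //.
  by apply: le_trans (target_le i ty) _; have := W_ge1; rewrite /T; lra.
have sE : \sum_i (g / k * (target x i * target y i) + e0) =
    g / k * (D * sign_image_dot x y) + D * e0.
  rewrite big_split /= sumr_const card_ord -[e0 *+ d]mulr_natl; congr (_ + _).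
  rewrite -big_distrr /=; congr (_ * _); rewrite /sign_image_dot big_distrr /=.
  apply: eq_bigr => i _; rewrite /target -[D in RHS]sqr_sqrtr ?ler0n//; ring.
rewrite {}sE.
have g2 : 4 * g ^+ 2 <= N ^+ 2.
  have -> : 4 * g ^+ 2 = (2 * `|g|) ^+ 2 by rewrite exprMn real_normK ?num_real//; ring.
  by rewrite lerXn2r// nnegrE// mulr_ge0.
have kE : k = (N + 2) ^+ 2 - g ^+ 2 by rewrite /k /g /dev; ring.
have n20 : 0 < N ^+ 2 :> R by rewrite exprn_gt0.
have kn : N ^+ 2 / 2 <= k by rewrite kE; lra.
have k0 : 0 < k by apply: lt_le_trans kn; rewrite divr_gt0.
have ki : k^-1 <= 2 / N ^+ 2.
  by rewrite -[leRHS]invrK lef_pV2 ?posrE ?invr_gt0 ?divr_gt0// invf_div.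
have DN0 : 0 <= D / N ^+ 2 by rewrite divr_ge0 ?ltW.
have cross : g / k * (D * sign_image_dot x y) <= D / N ^+ 2 * (g ^+ 2 + sign_image_dot x y ^+ 2).
  move: (sign_image_dot x y) => X; apply: (le_trans (ler_norm _)).
  have -> : `|g / k * (D * X)| = k^-1 * (D * (`|g| * `|X|)).
    rewrite !normrM normfV (gtr0_norm k0) (gtr0_norm D0); ring.
  apply: (@le_trans _ _ (2 / N ^+ 2 * (D * (`|g| * `|X|)))).
    by rewrite ler_wpM2r// !mulr_ge0// ltW.
  have -> : 2 / N ^+ 2 * (D * (`|g| * `|X|)) = D / N ^+ 2 * (2 * (`|g| * `|X|)) by ring.
  rewrite ler_wpM2l// -(@real_normK _ g) ?num_real// -(@real_normK _ X) ?num_real//.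
  by have := sqr_ge0 (`|g| - `|X|); lra.
have e0E : D * e0 = 2 * (D / N ^+ 2 * g ^+ 2) +
    D / N * (2 + 1800 * gamma + (100 * gamma) ^+ 2).
  have T2 : T ^+ 2 = 100 * gamma * N by rewrite /T exprMn W2; ring.
  have T4 : T ^+ 4 = (100 * gamma * N) ^+ 2 by rewrite -T2; ring.
  by rewrite /e0 T2 T4; field; rewrite gt_eqF.
have DNg : D / N <= gamma by rewrite ler_pdivrMr// D_le.
have DNg0 : 0 <= D / N by rewrite divr_ge0 ?ltW.
have small := small_exponent GS DNg0 DNg.
apply: (@le_trans _ _ (expR (3 * gamma + (3 * D / N ^+ 2 * g ^+ 2 +
    D / N ^+ 2 * sign_image_dot x y ^+ 2)))).
  rewrite ler_expR e0E.
  have -> : 3 * D / N ^+ 2 * g ^+ 2 = 3 * (D / N ^+ 2 * g ^+ 2) by ring.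
  move: cross small; rewrite mulrDr; lra.
rewrite expRD ler_wpM2l ?expR_ge0// expRD.
have -> : 6 * D / N ^+ 2 * g ^+ 2 = 2%:R * (3 * D / N ^+ 2 * g ^+ 2) by ring.
have -> : 2 * D / N ^+ 2 * sign_image_dot x y ^+ 2 = 2%:R * (D / N ^+ 2 * sign_image_dot x y ^+ 2) by ring.
rewrite !expRM_natl; move: (expR _) (expR _) => A B.
by have := sqr_ge0 (A - B); lra.
Qed.

Lemma prod_correlation_trivial x y : tame x -> tame y ->
  \prod_i correlation R slot x y i <= expR (N / 256).
Proof.
move=> tx ty; apply: (@le_trans _ _ (\prod_(i < d) expR (ln (48 * N) / 2))).
  apply: ler_prod => i _.
  have /andP[c0 c1] := correlation_le R slot_lt i tx ty.
  by rewrite c0 (le_trans c1)// rowp_inv_le.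
rewrite prodr_const card_ord -expRM_natl ler_expR mulrA; exact: ln_bound.
Qed.

Variable mu : signvec -> R.
Hypothesis mu_distr : distr mu.
Hypothesis mu_sub : forall (a : 'I_n -> R) (b : 'I_d -> R),
  subgaussian mu (8 * (\sum_k a k ^+ 2 + \sum_i b i ^+ 2))
    (fun x => \sum_k a k * (-1) ^+ x k + \sum_i b i * sign_image M x i).

Lemma sign_dot_subgaussian x : subgaussian mu (8 * N) (fun y => sign_dot R x y).
Proof.
move=> l; have := mu_sub (fun k => (-1) ^+ x k) (fun=> 0) l.
have -> : \sum_k ((-1) ^+ x k) ^+ 2 + \sum_(i < d) 0 ^+ 2 = N :> R.
  rewrite [X in _ + X]big1 => [|i _]; last by rewrite expr0n.
  under eq_bigr do rewrite sqrr_sign.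
  by rewrite sumr_const card_ord addr0.
apply: le_trans; apply: ler_sum => y _; rewrite ler_wpM2l ?(proj1 mu_distr)//.
by rewrite [X in _ + X]big1 ?addr0// => i _; rewrite mul0r.
Qed.

(** Linear in y with coefficients Mx, and tameness gives 8 |Mx|^2 <= 8 d (8 sqrt L)^2. *)
Lemma sign_image_dot_subgaussian x : tame x ->
  subgaussian mu (512 * (D * L)) (fun y => sign_image_dot x y).
Proof.
move=> /forallP tx; apply: (@subgaussianW _ _ _ (8 * \sum_i sign_image M x i ^+ 2)).
  have -> : 512 * (D * L) = 8 * \sum_(i < d) (8 * Num.sqrt L) ^+ 2.
    rewrite sumr_const card_ord -[X in 8 * X]mulr_natl exprMn sqr_sqrtr; last first.
      exact: le_trans ler01 L_ge1.
    by ring.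
  rewrite ler_wpM2l//; apply: ler_sum => i _.
  rewrite -real_normK ?num_real// lerXn2r ?nnegrE ?mulr_ge0 ?sqrtr_ge0//; exact: tx.
move=> l; have := mu_sub (fun=> 0) (sign_image M x) l.
rewrite [\sum_k _ ^+ 2]big1 ?add0r => [|k _]; last by rewrite expr0n.
apply: le_trans; apply: ler_sum => y _; rewrite ler_wpM2l ?(proj1 mu_distr)//.
by rewrite [X in _ * (X + _)]big1 ?add0r// => k _; rewrite mul0r.
Qed.

Lemma tame_mass : 1 - 2 / D <= \sum_(x | tame x) mu x.
Proof.
have [mu0 mu1] := mu_distr; have D0 : 0 < D by rewrite ltr0n.
have L1 := L_ge1.
rewrite -[X in X - _]mu1 (bigID tame) /= lerBlDr lerD2l.
apply: (@le_trans _ _ (\sum_i \sum_(x | 8 * Num.sqrt L < `|sign_image M x i|) mu x)).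
  under [leRHS]eq_bigr do rewrite big_mkcond.
  rewrite exchange_big /= big_mkcond; apply: ler_sum => x _.
  case: ifPn => [|_]; last by apply: sumr_ge0 => i _; case: ifP.
  rewrite negb_forall => /existsP[i]; rewrite -ltNge => xi.
  rewrite (bigD1 i)//= xi lerDl; apply: sumr_ge0 => l _; by case: ifP.
have -> : 2 / D = \sum_(i < d) 2 / D ^+ 2.
  by rewrite sumr_const card_ord -[RHS]mulr_natl; field; rewrite gt_eqF.
apply: ler_sum => i _.
have si : subgaussian mu 8 (fun x => sign_image M x i).
  move=> l; have := mu_sub (fun=> 0) (fun l => (l == i)%:R) l.
  rewrite [\sum_k _ ^+ 2]big1 ?add0r => [|k _]; last by rewrite expr0n.
  have -> : \sum_(k < d) (k == i)%:R ^+ 2 = 1 :> R.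
    rewrite (bigD1 i)//= eqxx expr1n big1 ?addr0// => k /negPf ->.
    by rewrite expr0n.
  rewrite mulr1; apply: le_trans; apply: ler_sum => x _; rewrite ler_wpM2l//.
  rewrite ler_expR [X in _ * (X + _)]big1 ?add0r => [|k _]; last by rewrite mul0r.
  have -> : \sum_k (k == i)%:R * sign_image M x k = sign_image M x i.
    rewrite (bigD1 i)//= eqxx mul1r big1 ?addr0// => k /negPf ->.
    by rewrite mul0r.
  by [].
have a0 : 0 <= 8 * Num.sqrt L by rewrite mulr_ge0 ?sqrtr_ge0.
apply: le_trans (subgaussian_tail mu0 _ a0 si) _ => //.
rewrite ler_wpM2l// exprMn sqr_sqrtr; last lra.
have -> : - (8 ^+ 2 * L / (4 * 8)) = - (2%:R * L) by field.
by rewrite expRN expRM_natl lnK.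
Qed.

Lemma tail_correlation_sum_le x : tame x ->
  \sum_(y | tame y && ~~ (2 * `|sign_dot R x y| <= N))
    mu y * \prod_i correlation R slot x y i <= 1000 * gamma.
Proof.
move=> tx; have [mu0 mu1] := mu_distr.
(* Since gamma N = d ln d >= 1, a bound of order 1 / N is also one of order gamma. *)
have gN1 : 1 <= gamma * N by have := D_le; have := D_ge2; move: (gamma * N); move=> *; lra.
apply: (@le_trans _ _ (\sum_(y | N / 2 < `|sign_dot R x y|) mu y * expR (N / 256))).
  rewrite big_mkcond [leRHS]big_mkcond /=; apply: ler_sum => y _.
  have m0 : 0 <= mu y * expR (N / 256) by rewrite mulr_ge0 ?mu0 ?expR_ge0.
  have [/andP[ty]|_] := boolP (_ && _); last by case: (_ < _).
  rewrite -ltNge mulrC -ltr_pdivrMr ?ltr0n// => ->.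
  by rewrite ler_wpM2l ?mu0 ?prod_correlation_trivial.
rewrite -big_distrl /=.
have V0 : 0 < 8 * N by rewrite mulr_gt0.
have a0 : 0 <= N / 2 by rewrite divr_ge0 ?ler0n.
apply: (le_trans (ler_wpM2r (expR_ge0 _) (subgaussian_tail mu0 V0 a0 (sign_dot_subgaussian x)))).
rewrite -mulrA -expRD.
have -> : - ((N / 2) ^+ 2 / (4 * (8 * N))) + N / 256 = - (N / 256).
  by field; rewrite gt_eqF.
have : expR (- (N / 256)) <= 256 * gamma.
  have n256 : 0 < N / 256 by rewrite divr_gt0 ?ltr0n.
  rewrite expRN; apply: (@le_trans _ _ (N / 256)^-1).
    rewrite lef_pV2 ?posrE ?expR_gt0//.
    by apply: le_trans (expR_ge1Dx _); rewrite lerDr ler01.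
  rewrite invf_div ler_pdivrMr ?ltr0n// -mulrA.
  by move: gN1; move: (gamma * N); move=> *; lra.
by move: (expR _) gamma_gt0; move=> *; lra.
Qed.

Lemma sign_dot_sqr_sum_le x :
  \sum_y mu y * expR (6 * D / N ^+ 2 * sign_dot R x y ^+ 2) <= 1 + 15 * (1000 * gamma).
Proof.
have [mu0 mu1] := mu_distr; have GS := gamma_small.
have DNg : D / N <= gamma by rewrite ler_pdivrMr// D_le.
have sV : 6 * D / N ^+ 2 * (8 * N) = 48 * (D / N) by field; rewrite gt_eqF.
have V0 : 0 < 8 * N by rewrite mulr_gt0.
have s0 : 0 <= 6 * D / N ^+ 2 by rewrite divr_ge0 ?mulr_ge0 ?exprn_ge0 ?ler0n.
have sV1 : 8 * (6 * D / N ^+ 2 * (8 * N)) <= 1.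
  by rewrite sV; move: DNg GS; move: (D / N); move=> *; lra.
apply: le_trans (subgaussian_sqr mu0 mu1 V0 s0 sV1 (sign_dot_subgaussian x)) _.
by rewrite sV; move: DNg gamma_gt0; move: (D / N) => *; lra.
Qed.

Lemma sign_image_dot_sqr_sum_le x : tame x ->
  \sum_y mu y * expR (2 * D / N ^+ 2 * sign_image_dot x y ^+ 2) <= 1 + 2 * gamma.
Proof.
move=> tx; have [mu0 mu1] := mu_distr; have GS := gamma_small; have G0 := gamma_gt0.
have DNg : D / N <= gamma by rewrite ler_pdivrMr// D_le.
have sV : 2 * D / N ^+ 2 * (512 * (D * L)) = 1024 * (D / N * gamma).
  by rewrite DLE; field; rewrite gt_eqF.
(* The factor D / N <= 10^-6 absorbs the constant 304 * 1024 and leaves a multiple of gamma. *)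
have gg : 1000 * (1000 * (D / N * gamma)) <= gamma.
  have -> : 1000 * (1000 * (D / N * gamma)) = (1000 * (1000 * (D / N))) * gamma by ring.
  apply: ler_piMl; first exact: ltW.
  by move: DNg GS; move: (D / N); move=> *; lra.
have V0 : 0 < 512 * (D * L) by rewrite mulr_gt0 ?ltr0n.
have s0 : 0 <= 2 * D / N ^+ 2 by rewrite divr_ge0 ?mulr_ge0 ?exprn_ge0 ?ler0n.
have sV1 : 8 * (2 * D / N ^+ 2 * (512 * (D * L))) <= 1.
  by rewrite sV; move: gg GS; move: (_ * gamma); move=> *; lra.
apply: le_trans (subgaussian_sqr mu0 mu1 V0 s0 sV1 (sign_image_dot_subgaussian tx)) _.
by rewrite sV; move: gg G0; move: (_ * gamma); move=> *; lra.
Qed.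

Lemma correlation_sum_le x : tame x ->
  \sum_(y | tame y) mu y * \prod_i correlation R slot x y i <= 1 + 10 * (1000 * gamma).
Proof.
move=> tx; have [mu0 mu1] := mu_distr.
rewrite (bigID (fun y => 2 * `|sign_dot R x y| <= N)) /=.
have S2 := tail_correlation_sum_le tx.
apply: total_bound gamma_gt0 gamma_small _ S2.
apply: (@le_trans _ _ (\sum_y mu y * (expR (3 * gamma) *
   ((expR (6 * D / N ^+ 2 * sign_dot R x y ^+ 2) +
     expR (2 * D / N ^+ 2 * sign_image_dot x y ^+ 2)) / 2)))).
  rewrite big_mkcond /=; apply: ler_sum => y _.
  have [/andP[ty gn]|_] := boolP (_ && _).
    by rewrite ler_wpM2l ?mu0 ?prod_correlation_le.
  apply: mulr_ge0 (mu0 _) _; apply: mulr_ge0 (expR_ge0 _) _.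
  by rewrite divr_ge0 ?addr_ge0 ?expR_ge0 ?ler0n.
have q1 := sign_dot_sqr_sum_le x; have q2 := sign_image_dot_sqr_sum_le tx.
have -> : \sum_y mu y * (expR (3 * gamma) *
   ((expR (6 * D / N ^+ 2 * sign_dot R x y ^+ 2) +
     expR (2 * D / N ^+ 2 * sign_image_dot x y ^+ 2)) / 2)) =
  expR (3 * gamma) * ((\sum_y mu y * expR (6 * D / N ^+ 2 * sign_dot R x y ^+ 2) +
    \sum_y mu y * expR (2 * D / N ^+ 2 * sign_image_dot x y ^+ 2)) / 2).
  rewrite -big_split /= big_distrl big_distrr /=; apply: eq_bigr => y _.
  by rewrite -mulrDr [LHS]mulrCA -[mu y * _ / 2]mulrA.
rewrite ler_wpM2l ?expR_ge0//.
have G0 := gamma_gt0.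
by move: (\sum_y _) (\sum_y _) q1 q2 => s1 s2 q1 q2; lra.
Qed.

(** The second moment method gives the proportion (1 - 2 / d)^2 / (1 + 10^4 gamma), here bounded
    below linearly. Both values of a slot are within 2 of the target, well inside 8. *)
Lemma small_discrepancy_count :
  (1 - 4 / D - 10 * (1000 * gamma)) * (2 ^+ n) ^+ d <=
  #|[set w : {ffun 'I_d -> signvec} | [exists x : signvec,
     [forall i, `|Num.sqrt D * sign_image M x i + sign_dot R (w i) x| <= 8]]]%SET|%:R.
Proof.
have [mu0 mu1] := mu_distr.
have jlt := slot_lt.
pose S := weighted_count mu tame slot.
apply: (@le_trans _ _ #|[set w | 0 < S w]%SET|%:R); last first.
  rewrite ler_nat subset_leq_card//; apply/fintype.subsetP => w.
  rewrite !inE => /weighted_count_gt0[x tx hx].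
  apply/existsP; exists x; apply/forallP => i; have := hx i.
  have [_ a0 a1 _ _] := slotP i tx.
  have e z : Num.sqrt D * sign_image M x i + z = z - target x i.
    by rewrite /target opprK addrC.
  rewrite e sign_dot_dev /hit => /orP[/eqP ->|/eqP ->].
    by apply: (le_trans a0); lra.
  by apply: (le_trans a1); lra.
have S0 w : 0 <= S w by exact: weighted_count_ge0.
have := paley_zygmund S0; rewrite /S weighted_count_mean// weighted_count_sqr//.
rewrite -/S; move: (#|_|%:R) (ler0n R #|[set w | 0 < S w]%SET|) => c c0.
set m := \sum_(x | tame x) mu x; set q := \sum_(x | tame x) \sum_(y | tame y) _.
have C0 : 0 < (2 ^+ n) ^+ d :> R by rewrite !exprn_gt0.
move: ((2 ^+ n) ^+ d) C0 => C C0.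
have q1 : q <= 1 + 10 * (1000 * gamma).
  apply: (@le_trans _ _ (\sum_(x | tame x) mu x * (1 + 10 * (1000 * gamma)))).
    apply: ler_sum => x tx; under eq_bigr do rewrite -mulrA.
    by rewrite -big_distrr /= ler_wpM2l// correlation_sum_le.
  rewrite -big_distrl /= -/m; apply: ler_piMl; first by have := gamma_gt0; lra.
  by rewrite -[leRHS]mu1 [leRHS](bigID tame) /= lerDl sumr_ge0.
have m1 := tame_mass; rewrite -/m in m1 *.
move=> h; have D2 := D_ge2; have G0 := gamma_gt0.
have {}h : C * m ^+ 2 <= c * (1 + 10 * (1000 * gamma)).
  have : C * (C * m ^+ 2) <= C * (c * q).
    have -> : C * (C * m ^+ 2) = (C * m) ^+ 2 by ring.
    by apply: (le_trans h); rewrite mulrCA.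
  by rewrite ler_pM2l// => /le_trans; apply; exact: ler_wpM2l.
have u0 : 0 <= 1 - 2 / D by rewrite subr_ge0 ler_pdivrMr; lra.
have mm : 1 - 4 / D <= m ^+ 2.
  apply: (@le_trans _ _ ((1 - 2 / D) ^+ 2)); last by rewrite lerXn2r// nnegrE (le_trans u0).
  have -> : 4 / D = 2 * (2 / D) by ring.
  by have := sqr_ge0 (2 / D); move: (2 / D) => u; lra.
have g1 : 0 < 1 + 10 * (1000 * gamma) by lra.
rewrite -(ler_pM2r g1); apply: le_trans h.
rewrite mulrAC mulrC ler_wpM2l ?(ltW C0)//.
apply: le_trans mm.
have : 0 <= 4 / D by rewrite divr_ge0//; lra.
move: (4 / D) => u u1; nra.
Qed.

End FiniteTheorem.

(** * From counting to probability *)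

Lemma mx_norm_le (R : realType) (d : nat) (v : 'cV[R]_d) (c : R) : 0 <= c ->
  (`|v| <= c) = [forall i, `|v i 0| <= c].
Proof.
move=> c0; rewrite [`|v|]/Num.Def.normr /= mx_normrE; apply/bigmax_leP/forallP => [[_ h] i|h].
  exact: (h (i, 0)).
by split=> // -[i k] _ /=; rewrite ord1.
Qed.

Lemma sign_vectorsE (R : realType) (n : nat) (v : 'cV[R]_n) :
  sign_vectors R n v -> exists x : {ffun 'I_n -> bool}, v = \col_k (-1) ^+ x k.
Proof.
move=> sv; exists [ffun k => v k 0 == -1]; apply/colP => k.
rewrite mxE ffunE; case: (sv k) => ->; last by rewrite eqxx expr1.
by rewrite -subr_eq0 opprK -(natrD _ 1 1) pnatr_eq0 expr0.
Qed.

Lemma sign_vectors_ffun (R : realType) (n : nat) (x : {ffun 'I_n -> bool}) :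
  sign_vectors R n (\col_k (-1) ^+ x k).
Proof. by move=> k; rewrite mxE; case: (x k); rewrite ?expr1 ?expr0; [right|left]. Qed.

(** Ranging over finitely many sign functions makes the event a finite union, both for counting and
    for measurability. *)
Lemma DISC_leP (R : realType) (d n : nat) (A : 'M[R]_(d, n)) (c : R) : 0 <= c ->
  DISC A <= c <-> exists x : {ffun 'I_n -> bool},
    forall i, `|\sum_k A i k * (-1) ^+ x k| <= c.
Proof.
move=> c0.
have AE x i : (A *m (\col_k (-1) ^+ x k : 'cV[R]_n)) i 0 = \sum_k A i k * (-1) ^+ x k.
  by rewrite mxE; apply: eq_bigr => k _; rewrite mxE.
split=> [|[x h]].
  have [v /sign_vectorsE[x ->] ->] := DISC_attained A.
  by rewrite mx_norm_le// => /forallP h; exists x => i; rewrite -AE.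
apply: (le_trans (DISC_le A (sign_vectors_ffun R x))).
by rewrite mx_norm_le//; apply/forallP => i; rewrite AE.
Qed.

Section Rademacher.
Context (R : realType) (disp : measure_display) (T : measurableType disp).
Variables (P : probability T R) (d n : nat) (X : 'I_d -> 'I_n -> {RV P >-> R}).
Hypothesis X_rademacher : rademacher X.
Notation signmat := {ffun 'I_d -> {ffun 'I_n -> bool}}.
Implicit Types s : signmat.

Definition cylinder s : set T :=
  \bigcap_(ik in [set` [set: 'I_d * 'I_n]%SET])
    (X ik.1 ik.2 @^-1` [set (-1) ^+ s ik.1 ik.2]).

Lemma measurable_cylinder s : measurable (cylinder s).
Proof.
apply: fin_bigcap_measurable; first exact: finite_finset.
by move=> ik _; exact: measurable_funPTI.
Qed.

Lemma cylinderP s w : cylinder s w <-> forall i k, X i k w = (-1) ^+ s i k.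
Proof.
split=> [h i k|h [i k] _]; last exact: h.
by apply: (h (i, k)); rewrite /= inE.
Qed.

Lemma probability_cylinder s : P (cylinder s) = (((2 ^+ n) ^+ d)^-1)%:E.
Proof.
have [indep marg] := X_rademacher.
rewrite /cylinder (indep _ (fun ik => [set (-1) ^+ s ik.1 ik.2])); last first.
  by move=> ik; exact: measurable_set1.
transitivity (\prod_(ik in [set: 'I_d * 'I_n]%SET) (2^-1 : R)%:E)%E.
  apply: eq_bigr => ik _; have [m1 m2] := marg ik.1 ik.2.
  by case: (s ik.1 ik.2); rewrite ?expr1 ?expr0.
rewrite prodEFin; congr (_%:E).
by rewrite prodr_const cardsT card_prod !card_ord exprVn mulnC exprM.
Qed.

(** The cylinders miss the null event that some entry is neither 1 nor -1, hence an inequality. *)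
Lemma probability_cylinders (A : {set signmat}) (E : set T) : measurable E ->
  (forall s, s \in A -> cylinder s `<=` E) ->
  ((#|A|%:R / (2 ^+ n) ^+ d)%:E <= P E)%E.
Proof.
move=> mE AE.
pose q : R := #|A|%:R / (2 ^+ n) ^+ d; rewrite -/q.
have -> : q%:E = P (\bigcup_(s in [set` enum A]) cylinder s).
  rewrite measure_fin_bigcup//.
  - rewrite -fsbig_seq ?enum_uniq//= big_enum /=.
    transitivity (\sum_(s in A) (((2 ^+ n) ^+ d)^-1 : R)%:E)%E.
      by rewrite sumEFin sumr_const /q mulr_natl.
    by apply: eq_bigr => s _; rewrite probability_cylinder.
  - move=> s s' _ _ [w [/cylinderP h /cylinderP h']].
    apply/ffunP => i; apply/ffunP => k.
    have := h i k; rewrite h'; case: (s i k); case: (s' i k) => //.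
      by move/eqP; rewrite expr0 expr1 -subr_eq0 opprK -(natrD _ 1 1) pnatr_eq0.
    by move/esym/eqP; rewrite expr0 expr1 -subr_eq0 opprK -(natrD _ 1 1) pnatr_eq0.
  - by move=> s _; exact: measurable_cylinder.
apply: le_measure; rewrite ?inE//.
  by apply: fin_bigcup_measurable => // s _; exact: measurable_cylinder.
by move=> w [s /=]; rewrite mem_enum => /AE; exact.
Qed.

Lemma measurable_DISC_le (M : 'M[R]_(d, n)) (a c : R) : 0 <= c ->
  measurable [set w | DISC (M + a *: random_matrix X w) <= c].
Proof.
move=> c0.
pose F (x : {ffun 'I_n -> bool}) (i : 'I_d) (w : T) : R :=
  `|\sum_k (M i k + a * X i k w) * (-1) ^+ x k|.
have FE (x : {ffun 'I_n -> bool}) i w : `|\sum_k (M + a *: random_matrix X w) i k * (-1) ^+ x k| = F x i w.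
  by congr `| _ |; apply: eq_bigr => k _; rewrite !mxE.
rewrite [X in measurable X](_ : _ = \bigcup_x \bigcap_i [set w | F x i w <= c]).
  apply: fin_bigcup_measurable; first exact: finite_finset.
  move=> x _; apply: fin_bigcap_measurable; first exact: finite_finset.
  move=> i _; have mF : measurable_fun setT (F x i).
    apply: measurableT_comp => //; apply: measurable_sum => k.
    apply: measurable_realfun.measurable_funM => //; apply: measurable_realfun.measurable_funD => //.
    exact: measurable_realfun.measurable_funM.
  rewrite -[X in measurable X]setTI.
  rewrite (_ : [set w | F x i w <= c] = F x i @^-1` `]-oo, c]%classic).
    exact: mF.
  by apply/seteqP; split => w /=; rewrite in_itv.
apply/seteqP; split => w.
  by move=> /(DISC_leP _ c0)[x h]; exists x => // i _ /=; rewrite -FE.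
by move=> [x _ h]; apply/(DISC_leP _ c0); exists x => i; rewrite FE; exact: h.
Qed.

End Rademacher.

Lemma probability_small_DISC (R : realType) (disp : measure_display)
    (T : measurableType disp) (P : probability T R) (d n : nat)
    (M : 'M[R]_(d, n)) (X : 'I_d -> 'I_n -> {RV P >-> R}) (gamma : R) :
  komlos M -> rademacher X -> (0 < n)%N -> 1 <= ln d%:R :> R ->
  d%:R * ln d%:R = gamma * n%:R -> 1000 * (1000 * gamma) <= 1 ->
  ((1 - 4 / d%:R - 10 * (1000 * gamma))%:E <=
   P [set w | (DISC (M + (Num.sqrt d%:R)^-1 *: random_matrix X w)
               <= 8 * (Num.sqrt d%:R)^-1)%R])%E.
Proof.
move=> kM rX n0 L1 gE gs.
have sM k : \sum_(i < d) M i k ^+ 2 <= 1.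
  have := kM k; rewrite -{1}sqrtr1 ler_sqrt//.
have [mu dmu smu] := komlos_distr sM.
have := small_discrepancy_count n0 L1 gE gs dmu smu.
set A := finset _ => cA.
have d0 : 0 < d%:R :> R.
  rewrite ltr0n; case: (d) L1 => // d0; exfalso.
  by move: d0; rewrite ln0// ler10.
have s0 : 0 < Num.sqrt d%:R :> R by rewrite sqrtr_gt0.
have c0 : 0 <= 8 * (Num.sqrt d%:R)^-1 :> R by rewrite mulr_ge0// invr_ge0 ltW.
have C0 : 0 < (2 ^+ n) ^+ d :> R by rewrite !exprn_gt0.
apply: le_trans (@probability_cylinders _ _ _ _ _ _ _ rX A _ (measurable_DISC_le X M _ c0) _);
  last first.
  move=> s; rewrite /A inE => /existsP[x /forallP h] w /cylinderP Xs.
  apply/(DISC_leP _ c0); exists x => i; have := h i.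
  have -> : \sum_k (M + (Num.sqrt d%:R)^-1 *: random_matrix X w) i k * (-1) ^+ x k =
      (Num.sqrt d%:R)^-1 * (Num.sqrt d%:R * sign_image M x i + sign_dot R (s i) x).
    rewrite mulrDr mulKf ?gt_eqF// /sign_image /sign_dot big_distrr -big_split /=.
    by apply: eq_bigr => k _; rewrite !mxE Xs mulrDl mulrA.
  move=> hi; rewrite normrM gtr0_norm ?invr_gt0// mulrC.
  by rewrite ler_wpM2r// invr_ge0 ltW.
by rewrite lee_fin ler_pdivlMr.
Qed.

Theorem theorem1p1 (R : realType) (d n : nat -> nat)
    (d_gt0 : forall j, (0 < d j)%N) (n_gt0 : forall j, (0 < n j)%N)
    (d_oo : d j @[j --> \oo] --> \oo)
    (n_oo : (n j)%:R / ((d j)%:R * ln (d j)%:R) @[j --> \oo] --> (+oo : set_system R))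
    (M : forall j, 'M[R]_(d j, n j)) (M_komlos : forall j, komlos (M j))
    (disp : nat -> measure_display) (T : forall j, measurableType (disp j))
    (P : forall j, probability (T j) R)
    (X : forall j, 'I_(d j) -> 'I_(n j) -> {RV (P j) >-> R})
    (X_rademacher : forall j, rademacher (X j)) :
  P j [set w | DISC (M j + (Num.sqrt (d j)%:R)^-1 *: random_matrix (X j) w)
               <= 8 * (Num.sqrt (d j)%:R)^-1] @[j --> \oo] --> 1%:E.
Proof.
(* This is d ln d / n, written as the inverse of the sequence assumed to diverge; the default values
   at d = 1 occur for finitely many j only. *)
pose gamma j : R := ((n j)%:R / ((d j)%:R * ln (d j)%:R))^-1.
have dR_oo : (d j)%:R @[j --> \oo] --> (+oo : set_system R) by apply/cvgrnyP.
have dV0 : ((d j)%:R : R)^-1 @[j --> \oo] --> (0 : R).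
  apply/gtr0_cvgV0; last exact: dR_oo.
  by apply: nearW => j; rewrite ltr0n.
have gamma0 : gamma j @[j --> \oo] --> (0 : R).
  apply/gtr0_cvgV0; last exact: n_oo.
  have /cvgryPgt/(_ 0) := n_oo; exact.
have lower : 1 - 4 / (d j)%:R - 10 * (1000 * gamma j) @[j --> \oo] --> (1 : R).
  rewrite [X in _ --> X](_ : _ = 1 - 4 * 0 - 10 * (1000 * 0)); last first.
    by rewrite !mulr0 !subr0.
  apply: cvgB; [apply: cvgB; [exact: cvg_cst|]|].
    by apply: cvgM; [exact: cvg_cst|exact: dV0].
  by apply: cvgM; [exact: cvg_cst|apply: cvgM; [exact: cvg_cst|exact: gamma0]].
have lowerE : (1 - 4 / (d j)%:R - 10 * (1000 * gamma j))%:E @[j --> \oo]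
    --> (1%:E : \bar R).
  by apply: cvg_EFin; [exact: nearW|exact: lower].
apply: squeeze_cvge; [|exact: lowerE|exact: cvg_cst].
have d4 : \forall j \near \oo, 4 <= (d j)%:R :> R.
  by have /cvgryPge/(_ 4) := dR_oo; exact.
have gs : \forall j \near \oo, gamma j < (1000 * 1000)^-1.
  have /cvgr_lt/(_ (1000 * 1000)^-1) := gamma0; apply.
  by rewrite invr_gt0 mulr_gt0 ?ltr0n.
near=> j.
rewrite probability_le1 ?andbT; last first.
  apply: measurable_DISC_le; rewrite mulr_ge0// invr_ge0 sqrtr_ge0//.
apply: (probability_small_DISC (gamma := gamma j) (M_komlos j) (X_rademacher j) (n_gt0 j)).
- have d4j : 4 <= (d j)%:R :> R by near: j.
  rewrite -[leLHS]expRK ler_ln ?posrE ?expR_gt0 ?ltr0n//; apply: le_trans d4j.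
  (* ln d >= 1 follows from e <= 4 <= d, where e^{1/2} <= 2 comes from [expR_le_inv1B]. *)
  have -> : expR 1 = expR 2^-1 ^+ 2 :> R.
    by rewrite -expRM_natl; congr expR; field.
  rewrite [leRHS](_ : _ = 2 ^+ 2); last by ring.
  rewrite lerXn2r ?nnegrE ?expR_ge0//; apply: le_trans (expR_le_inv1B _) _; first lra.
  by rewrite -[leLHS]mul1r ler_pdivrMr; lra.
- rewrite /gamma invf_div divfK// gt_eqF// ltr0n//.
- have : gamma j < (1000 * 1000)^-1 by near: j.
  have k0 : 0 < 1000 * 1000 :> R by rewrite mulr_gt0 ?ltr0n.
  by move=> h; apply: ltW; rewrite mulrA -(ltr_pdivlMl _ _ k0) mulr1; exact: h.
Unshelve. all: by end_near. Qed.
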